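(* Let $f$ satisfy $f(0,0)=0$ and (Mon) with $M_y<0$, and let the square-integrable terminal condition satisfy $\xi=g(X_T)\neq0$. When $8L_z^2\le -M_y$, $\alpha<\frac1{2(m-1)}$ and $$h\le\min\left\{\frac{-M_y}{4}\,\frac1{4(d+1)L_y^2},\ \Big(\frac{-M_y}{4}\,\frac{1}{4(d+1)L_y^2R_0^{2(m-1)}}\Big)^{\frac1{1-2(m-1)\alpha}}\right\},$$ the output $(Y_i)$ of the Full-Projection scheme satisfies, for all $i\le N-1$, $$\|Y_i\|_2\le e^{c'(T-t_i)}\|\xi^N\|_2<\|\xi^N\|_2,\qquad\text{with } c'=\frac{M_y}{2}<0,$$ where $\xi^N=g(X_N)$ is the terminal value of the scheme and $\|\cdot\|_2$ denotes the $L^2$-norm.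
   Context: $T>0$; $W$ is a $d$-dimensional Brownian motion with its usual augmented filtration $(\mathcal F_t)_{t\in[0,T]}$; $t_i=ih$, $h=T/N$, $i=0,\dots,N$; $\mathbb E_i=\mathbb E[\cdot|\mathcal F_{t_i}]$; $\Delta W_{t_{i+1}}=W_{t_{i+1}}-W_{t_i}$. Fix $x_0\in\mathbb R^d$. $b:[0,T]\times\mathbb R^d\to\mathbb R^d$, $\sigma:[0,T]\times\mathbb R^d\to\mathbb R^{d\times d}$ are $\frac12$-Hölder in time and Lipschitz in space; $g:\mathbb R^d\to\mathbb R^n$ is Lipschitz. The driver $f:\mathbb R^n\times\mathbb R^{n\times d}\to\mathbb R^n$ satisfies, with $M_y\in\mathbb R$, $L_y,L_z\ge0$, integer $m\ge2$, for all $y,y',z,z'$: (Mon) $\langle y'-y,f(y',z)-f(y,z)\rangle\le M_y|y'-y|^2$; (RegY) $|f(y',z)-f(y,z)|\le L_y(1+|y'|^{m-1}+|y|^{m-1})|y'-y|$; (RegZ) $|f(y,z')-f(y,z)|\le L_z|z'-z|$. The continuous-time forward process is $X_t=x_0+\int_0^t b(u,X_u)du+\int_0^t\sigma(u,X_u)dW_u$, $t\in[0,T]$, and $X_T$ is its value at time $T$; $\xi=g(X_T)$ is the terminal condition of the continuous-time BSDE $Y_t=\xi+\int_t^Tf(Y_u,Z_u)du-\int_t^TZ_u\,dW_u$. Euler scheme (discrete index): starting value $x_0$ at $i=0$ and $X_{i+1}=X_i+b(t_i,X_i)h+\sigma(t_i,X_i)\Delta W_{t_{i+1}}$. Full-Projection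 scheme: $Y_N=\xi^N=g(X_N)$ and for $i=N-1,\dots,0$: $Z_i=\mathbb E_i[T^h(Y_{i+1})H_{i+1}^*]$, $Y_i=\mathbb E_i[T^h(Y_{i+1})+f(T^h(Y_{i+1}),Z_i)h]$. Here $T^h:\mathbb R^n\to\mathbb R^n$ is a projection on the ball of radius $R^h=R_0h^{-\alpha}$ ($R_0>0$ and $\alpha>0$ constants), e.g. $T^h(y)=\min(1,R^h|y|^{-1})y$; it satisfies $|T^h(y)|\le|y|$, $|T^h(y)|\le R^h$, $T^h(y)=y$ when $|y|\le R^h$, and is $1$-Lipschitz. The weights $H_{i+1}$ are $\mathbb R^{d\times1}$-valued random variables, independent of $\mathcal F_{t_i}$ and martingale increments, $\mathbb E_i[H_{i+1}]=0$, with $\mathbb E_i[H_{i+1}H_{i+1}^*]=\Lambda h^{-1}I_d$, $\Lambda=\Lambda(h)\le1$, and $\max_i\mathbb E[|\Delta W_{t_{i+1}}/h-H_{i+1}|^2]\le Ch$ for a positive constant $C$.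
   Formalization: The strict inequality is stated under the extra assumption that ξ^N=g(X_N) is not almost surely zero, since ξ=g(X_T)≠0 does not imply ξ^N≠0 and the strict bound fails when ξ^N=0. *)

(* Defs.v *)
From HB Require Import structures.
From mathcomp Require Import all_boot all_order all_algebra.
From mathcomp Require Import all_classical all_reals all_analysis.

Set Implicit Arguments.
Unset Strict Implicit.
Unset Printing Implicit Defensive.

Import Order.TTheory GRing.Theory Num.Theory.
Import numFieldNormedType.Exports.

Local Open Scope classical_set_scope.
Local Open Scope ring_scope.

(* The library's norm `|A| on matrices is the sup norm; the norm used here is
   the Euclidean one (Frobenius norm on matrices). *)
Definition enorm (R : realType) p q (A : 'M[R]_(p, q)) : R :=
  Num.sqrt (\sum_(i < p) \sum_(j < q) A i j ^+ 2).

Definition edot (R : realType) p (x y : 'cV[R]_p) : R :=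
  \sum_(i < p) x i 0 * y i 0.

Section Coefficients.
Context {R : realType}.

Definition lipschitz_fun p q (g : 'cV[R]_p -> 'cV[R]_q) : Prop :=
  exists K : R, forall x y, enorm (g x - g y) <= K * enorm (x - y).

Definition half_holder_lipschitz (T : R) d p q
    (b : R -> 'cV[R]_d -> 'M[R]_(p, q)) : Prop :=
  exists K : R, forall s t x y,
    0 <= s <= T -> 0 <= t <= T ->
    enorm (b t x - b s y) <= K * (Num.sqrt `|t - s| + enorm (x - y)).

Definition monotone_driver n d
    (f : 'cV[R]_n -> 'M[R]_(n, d) -> 'cV[R]_n) (My : R) : Prop :=
  forall y y' z, edot (y' - y) (f y' z - f y z) <= My * enorm (y' - y) ^+ 2.

Definition regular_in_y n d
    (f : 'cV[R]_n -> 'M[R]_(n, d) -> 'cV[R]_n) (Ly : R) (m : nat) : Prop :=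
  forall y y' z, enorm (f y' z - f y z) <=
    Ly * (1 + enorm y' ^+ m.-1 + enorm y ^+ m.-1) * enorm (y' - y).

Definition regular_in_z n d
    (f : 'cV[R]_n -> 'M[R]_(n, d) -> 'cV[R]_n) (Lz : R) : Prop :=
  forall y z z', enorm (f y z' - f y z) <= Lz * enorm (z' - z).

Definition ball_projection n (r : R) (Th : 'cV[R]_n -> 'cV[R]_n) : Prop :=
  [/\ forall y, enorm (Th y) <= enorm y,
      forall y, enorm (Th y) <= r,
      forall y, enorm y <= r -> Th y = y
    & forall y y', enorm (Th y - Th y') <= enorm (y - y')].

End Coefficients.

Section Probability.
Context {disp : measure_display} {Omega : measurableType disp} {R : realType}.
Variable P : probability Omega R.

(* Random vectors and matrices: measurability, integrals and conditional
   expectations are taken entry by entry. *)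

Definition random_mx p q (X : Omega -> 'M[R]_(p, q)) : Prop :=
  forall i j, measurable_fun [set: Omega] (fun w => X w i j).

Definition wrt (G : set (set Omega)) p q (X : Omega -> 'M[R]_(p, q)) : Prop :=
  forall i j (B : set R), measurable B -> G ((fun w => X w i j) @^-1` B).

Definition sigma_of p q (X : Omega -> 'M[R]_(p, q)) : set (set Omega) :=
  <<s [set A | exists i j (B : set R),
         measurable B /\ A = (fun w => X w i j) @^-1` B] >>.

Definition independent_systems (G1 G2 : set (set Omega)) : Prop :=
  forall A B, G1 A -> G2 B -> P (A `&` B) = (P A * P B)%E.

Definition L2norm p q (X : Omega -> 'M[R]_(p, q)) : \bar R :=
  ('N[P]_2%:E [ (fun w => (enorm (X w))%:E) ])%E.

Definition as_zero p q (X : Omega -> 'M[R]_(p, q)) : Prop :=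
  {ae P, forall w, X w = 0}.

(* E is a version of the conditional expectation of X given the
   sub-sigma-algebra G. *)
Definition is_condexp (G : set (set Omega)) p q
    (X E : Omega -> 'M[R]_(p, q)) : Prop :=
  wrt G E /\ forall i j,
    [/\ P.-integrable [set: Omega] (fun w => (X w i j)%:E),
        P.-integrable [set: Omega] (fun w => (E w i j)%:E)
      & forall A, G A ->
          (\int[P]_(w in A) (X w i j)%:E = \int[P]_(w in A) (E w i j)%:E)%E].

Definition natural_filtration d (W : R -> Omega -> 'cV[R]_d) (t : R) :
    set (set Omega) :=
  <<s [set A | exists s i (B : set R),
         [/\ 0 <= s <= t, measurable B & A = (fun w => W s w i 0) @^-1` B]] >>.

(* Augmentation by the P-null events of Omega; when P is complete these are all
   the subsets of null events. *)
Definition augmented_filtration d (W : R -> Omega -> 'cV[R]_d) (t : R) :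
    set (set Omega) :=
  <<s natural_filtration W t `|` [set A | measurable A /\ P A = 0%E] >>.

(* normal_prob 0 s is the centred normal law with standard deviation s. *)
Definition brownian_motion (T : R) d (W : R -> Omega -> 'cV[R]_d) : Prop :=
  [/\ forall t, 0 <= t <= T -> random_mx (W t),
      as_zero (W 0),
      {ae P, forall w, forall i,
        {within `[0, T], continuous (fun t => W t w i 0)}},
      forall s t, 0 <= s -> s < t -> t <= T ->
        independent_systems (natural_filtration W s)
          (sigma_of (fun w => W t w - W s w))
    & forall s t, 0 <= s -> s < t -> t <= T ->
        forall B : 'I_d -> set R, (forall i, measurable (B i)) ->
        P [set w | forall i, B i (W t w i 0 - W s w i 0)] =
        (\prod_(i < d) normal_prob 0 (Num.sqrt (t - s)) (B i))%E].

(* The Ito integral of matrix-valued integrands, as the L^2-closure of the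
   integral of simple processes
     \sum_(k < K) V_k 1_(s_k, s_k.+1],
   where V_k is bounded and F_(s_k)-measurable. *)

Definition simple_process (F : R -> set (set Omega)) (t : R) p q
    (K : nat) (s : nat -> R) (V : nat -> Omega -> 'M[R]_(p, q)) : Prop :=
  [/\ s 0 = 0, s K = t, forall k, (k < K)%N -> s k <= s k.+1
    & forall k, (k < K)%N -> wrt (F (s k)) (V k) /\
        exists c : R, forall w, enorm (V k w) <= c].

Definition simple_value p q (K : nat) (s : nat -> R)
    (V : nat -> Omega -> 'M[R]_(p, q)) (u : R) (w : Omega) : 'M[R]_(p, q) :=
  \sum_(k < K) (s k < u <= s k.+1)%R%:R *: V k w.

Definition simple_integral d (W : R -> Omega -> 'cV[R]_d) p (K : nat)
    (s : nat -> R) (V : nat -> Omega -> 'M[R]_(p, d)) (w : Omega) : 'cV[R]_p :=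
  \sum_(k < K) V k w *m (W (s k.+1) w - W (s k) w).

Definition is_ito_integral d (W : R -> Omega -> 'cV[R]_d) (t : R) p
    (Phi : R -> Omega -> 'M[R]_(p, d)) (J : Omega -> 'cV[R]_p) : Prop :=
  random_mx J /\
  exists (K : nat -> nat) (s : nat -> nat -> R)
         (V : nat -> nat -> Omega -> 'M[R]_(p, d)),
    [/\ forall l, simple_process (augmented_filtration W) t (K l) (s l) (V l),
        (fun l => \int[P]_w \int[lebesgue_measure]_(u in `[0%R, t])
           (enorm (Phi u w - simple_value (K l) (s l) (V l) u w) ^+ 2)%:E)%E
          @ \oo --> 0%E
      & (fun l => \int[P]_w
           (enorm (J w - simple_integral W (K l) (s l) (V l) w) ^+ 2)%:E)%E
          @ \oo --> 0%E].

Definition sde_solution (T : R) d (W : R -> Omega -> 'cV[R]_d) (x0 : 'cV[R]_d)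
    (b : R -> 'cV[R]_d -> 'cV[R]_d) (sigma : R -> 'cV[R]_d -> 'M[R]_d)
    (X : R -> Omega -> 'cV[R]_d) : Prop :=
  [/\ forall t, 0 <= t <= T -> wrt (augmented_filtration W t) (X t),
      {ae P, forall w, forall i,
        {within `[0, T], continuous (fun t => X t w i 0)}}
    & forall t, 0 <= t <= T -> exists2 J : Omega -> 'cV[R]_d,
        is_ito_integral W t (fun u w => sigma u (X u w)) J
      & {ae P, forall w, X t w = x0
          + \col_(i < d) Rintegral lebesgue_measure `[0, t]
                            (fun u => b u (X u w) i 0)
          + J w}].

Fixpoint euler (h : R) d (W : R -> Omega -> 'cV[R]_d) (x0 : 'cV[R]_d)
    (b : R -> 'cV[R]_d -> 'cV[R]_d) (sigma : R -> 'cV[R]_d -> 'M[R]_d)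
    (i : nat) (w : Omega) : 'cV[R]_d :=
  if i is j.+1 then
    let x := euler h W x0 b sigma j w in
    x + h *: b (j%:R * h) x
      + sigma (j%:R * h) x *m (W (j.+1%:R * h) w - W (j%:R * h) w)
  else x0.

(* The weights are H 1, ..., H N; H 0 is unused. *)
Definition scheme_weights (h : R) (N : nat) d (W : R -> Omega -> 'cV[R]_d)
    (Lambda C : R) (H : nat -> Omega -> 'cV[R]_d) : Prop :=
  forall i, (i < N)%N ->
    [/\ wrt (augmented_filtration W (i.+1%:R * h)) (H i.+1),
        independent_systems (augmented_filtration W (i%:R * h))
          (sigma_of (H i.+1)),
        is_condexp (augmented_filtration W (i%:R * h)) (H i.+1) (fun=> 0),
        is_condexp (augmented_filtration W (i%:R * h))
          (fun w => H i.+1 w *m (H i.+1 w)^T) (fun=> (Lambda * h^-1)%:M)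
      & (\int[P]_w (enorm (h^-1 *: (W (i.+1%:R * h) w - W (i%:R * h) w)
                           - H i.+1 w) ^+ 2)%:E <= (C * h)%:E)%E].

Definition full_projection_scheme (h : R) (N : nat) n d
    (W : R -> Omega -> 'cV[R]_d)
    (f : 'cV[R]_n -> 'M[R]_(n, d) -> 'cV[R]_n) (Th : 'cV[R]_n -> 'cV[R]_n)
    (H : nat -> Omega -> 'cV[R]_d) (xiN : Omega -> 'cV[R]_n)
    (Y : nat -> Omega -> 'cV[R]_n) (Z : nat -> Omega -> 'M[R]_(n, d)) : Prop :=
  Y N = xiN /\
  forall i, (i < N)%N ->
    is_condexp (augmented_filtration W (i%:R * h))
      (fun w => Th (Y i.+1 w) *m (H i.+1 w)^T) (Z i) /\
    is_condexp (augmented_filtration W (i%:R * h))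
      (fun w => Th (Y i.+1 w) + h *: f (Th (Y i.+1 w)) (Z i w)) (Y i).

End Probability.

(* Main.v *)
Require Import Defs.
From HB Require Import structures.
From mathcomp Require Import all_boot all_order all_algebra.
From mathcomp Require Import all_classical all_reals all_analysis.
From mathcomp Require Import measurable_realfun ring lra.

Set Implicit Arguments.
Unset Strict Implicit.
Unset Printing Implicit Defensive.

Import Order.TTheory GRing.Theory Num.Theory.
Import numFieldNormedType.Exports.

Local Open Scope classical_set_scope.
Local Open Scope ring_scope.

(** The theorem is an energy estimate: each step of the scheme contracts the
   second moment,
     E|Y_i|^2 <= (1 - h mu) E|Y_(i+1)|^2,   mu = - My > 0,
   and 1 - h mu <= exp (- mu h), so that iterating from t_N = T down to t_i and
   taking square roots gives the rate My / 2.

   Write U for T^h(Y_(i+1)), F for f(U, Z_i) and A for U + h F, so that Y_i is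
   the conditional expectation of A. The contraction has two ingredients.

   - In mean, |Y_i|^2 equals |A|^2 - |A - Y_i|^2. The subtracted variance
     dominates h |Z_i|^2 / 2 up to h^2 |F|^2, since Z_i collects the
     coefficients of U - Y_i against the martingale weights (condexp_step_le,
     resting on the algebra of one_step_algebra).

   - Pointwise, monotonicity gives 2 h <U, F> <= - 2 h mu |U|^2 plus a term in
     |U| |Z_i|. As 8 Lz^2 <= mu, that term and the part of h^2 |F|^2 coming from
     Z_i are absorbed by h |Z_i|^2 / 2 and a fraction of the gain. Since the
     projection bounds |U| by R0 h^(- alpha), the part of h^2 |F|^2 coming from
     the polynomial growth in y is at most another fraction of the gain, and
     this is what the two bounds on h say (driver_dissipation,
     step_size_bounds).

   Conditional expectations are given only through integrals over events of the
   sigma-algebra, and the square integrability of Y_i and Z_i is not known in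
   advance. All identities in mean are therefore obtained on the events where Y_i
   and Z_i are bounded by k: a centred variable is orthogonal to bounded
   measurable functions (centred_test), and k goes to infinity by monotone
   convergence (integral_le_sublevel).

   The strict inequality also asks for 0 < ||xi^N||_2 < oo. Finiteness follows
   from the second moments of the Euler scheme (sqint_euler), which propagate
   because a Brownian increment is independent of the past (sqintM_indep). *)

(** * Euclidean norms and the algebra of one step *)

Section Euclidean.
Context {R : realType}.

Lemma sqr_enorm p q (A : 'M[R]_(p, q)) :
  enorm A ^+ 2 = \sum_i \sum_j A i j ^+ 2.
Proof.
by rewrite /enorm sqr_sqrtr//; apply: sumr_ge0 => i _; apply: sumr_ge0 => j _;
  rewrite sqr_ge0.
Qed.

Lemma sqr_enormc p (x : 'cV[R]_p) : enorm x ^+ 2 = \sum_i x i 0 ^+ 2.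
Proof. by rewrite sqr_enorm; apply: eq_bigr => i _; rewrite big_ord1. Qed.

Lemma enorm_ge0 p q (A : 'M[R]_(p, q)) : 0 <= enorm A.
Proof. exact: sqrtr_ge0. Qed.

Lemma enorm0 p q : enorm (0 : 'M[R]_(p, q)) = 0.
Proof.
rewrite /enorm big1 ?sqrtr0// => i _; rewrite big1// => j _.
by rewrite mxE expr0n.
Qed.

Lemma normr_entry_le p q (A : 'M[R]_(p, q)) i j : `|A i j| <= enorm A.
Proof.
rewrite -(@ler_pXn2r _ 2) ?nnegrE ?enorm_ge0// real_normK ?num_real//.
rewrite sqr_enorm (bigD1 i)//= (bigD1 j)//= -addrA lerDl addr_ge0//.
  by apply: sumr_ge0 => k _; rewrite sqr_ge0.
by apply: sumr_ge0 => k _; apply: sumr_ge0 => l _; rewrite sqr_ge0.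
Qed.

Lemma enorm_le_bound p q (A : 'M[R]_(p, q)) (e : R) :
  (forall i j, `|A i j| <= e) -> enorm A ^+ 2 <= (p * q)%:R * e ^+ 2.
Proof.
move=> Ae; rewrite sqr_enorm.
have -> : (p * q)%:R * e ^+ 2 = \sum_(i < p) \sum_(j < q) e ^+ 2.
  by rewrite !sumr_const !card_ord -mulrnA mulr_natl mulnC.
apply: ler_sum => i _; apply: ler_sum => j _.
rewrite -[X in X <= _]real_normK ?num_real//.
by rewrite ler_pXn2r ?nnegrE//; exact: le_trans (Ae i j).
Qed.

(** Cauchy-Schwarz, from the nonnegativity of the square of |y| x - |x| y. *)
Lemma edot_le_enormM p (x y : 'cV[R]_p) : edot x y <= enorm x * enorm y.
Proof.
have [x0|x0] := eqVneq (enorm x) 0.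
  rewrite x0 mul0r /edot big1// => i _.
  have := normr_entry_le x i 0; rewrite x0 normr_le0 => /eqP ->.
  by rewrite mul0r.
have [y0|y0] := eqVneq (enorm y) 0.
  rewrite y0 mulr0 /edot big1// => i _.
  have := normr_entry_le y i 0; rewrite y0 normr_le0 => /eqP ->.
  by rewrite mulr0.
set a := enorm x; set b := enorm y.
have a0 : 0 < a by rewrite lt_neqAle eq_sym x0 enorm_ge0.
have b0 : 0 < b by rewrite lt_neqAle eq_sym y0 enorm_ge0.
have : 0 <= \sum_i (b * x i 0 - a * y i 0) ^+ 2.
  by apply: sumr_ge0 => i _; rewrite sqr_ge0.
have -> : \sum_i (b * x i 0 - a * y i 0) ^+ 2
    = b ^+ 2 * a ^+ 2 + a ^+ 2 * b ^+ 2 - (2 * a * b) * edot x y.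
  have -> : a ^+ 2 = \sum_i x i 0 ^+ 2 by exact: sqr_enormc.
  rewrite mulr_sumr.
  have -> : b ^+ 2 = \sum_i y i 0 ^+ 2 by exact: sqr_enormc.
  rewrite /edot mulr_sumr -big_split/= mulr_sumr -sumrB.
  by apply: eq_bigr => i _; rewrite -(sqr_enormc y) -(sqr_enormc x) -/a -/b; ring.
move=> H.
have {}H : (2 * a * b) * edot x y <= (2 * a * b) * (a * b) by lra.
by rewrite ler_pM2l in H => //; rewrite !mulr_gt0.
Qed.

(** The continuous part of the one-step estimate: monotonicity gives
   -2 h mu |u|^2, of which at most a quarter is spent on the z-dependence of the
   driver (along with half of - (h / 2) |z|^2) and at most a quarter on the
   y-part of 2 h^2 |f|^2, which the step size restriction controls; the z-part
   takes the other half of - (h / 2) |z|^2. *)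
Lemma driver_dissipation n d (f : 'cV[R]_n -> 'M[R]_(n, d) -> 'cV[R]_n)
    (mu Ly Lz rho h : R) (m : nat) (u : 'cV[R]_n) (z : 'M[R]_(n, d)) :
  (1 < m)%N -> 0 <= Ly -> 0 <= Lz -> 0 < h -> 0 <= mu ->
  monotone_driver f (- mu) -> regular_in_y f Ly m -> regular_in_z f Lz ->
  f 0 0 = 0 -> 8 * Lz ^+ 2 <= mu -> h * mu <= 2^-1 ->
  enorm u ^+ m.-1 <= rho ->
  h * Ly ^+ 2 * (1 + rho ^+ 2) <= mu / 16 ->
  enorm (u + h *: f u z) ^+ 2 + h ^+ 2 * enorm (f u z) ^+ 2
    - h / 2 * enorm z ^+ 2 <= (1 - h * mu) * enorm u ^+ 2.
Proof.
move=> m1 Ly0 Lz0 h0 mu0 fmon fy fz f0 Lzmu hmu urho hLy.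
have nu0 := enorm_ge0 u; have nz0 := enorm_ge0 z.
have fz0 : enorm (f 0 z) <= Lz * enorm z.
  by have := fz 0 0 z; rewrite f0 !subr0.
have fyu : enorm (f u z - f 0 z) <= Ly * (1 + rho) * enorm u.
  have := fy 0 u z; rewrite subr0 enorm0 expr0n.
  rewrite (_ : (m.-1 == 0)%N = false); last by case: m m1 {fy urho} => [|[]].
  rewrite addr0 => /le_trans; apply; rewrite ler_wpM2r// ler_wpM2l//.
  by rewrite lerD2l.
set F := f u z; set a := enorm u; set b := enorm z.
have dotF : edot u F <= - mu * a ^+ 2 + a * (Lz * b).
  have -> : edot u F = edot (u - 0) (F - f 0 z) + edot u (f 0 z).
    by rewrite /edot -big_split/=; apply: eq_bigr => i _; rewrite !mxE; ring.
  apply: lerD; first by have := fmon 0 u z; rewrite !subr0.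
  by apply: le_trans (edot_le_enormM _ _) _; rewrite ler_wpM2l.
have normF : enorm F ^+ 2 <= 2 * (Ly * (1 + rho) * a) ^+ 2 + 2 * (Lz * b) ^+ 2.
  apply: (@le_trans _ _
      (2 * enorm (F - f 0 z) ^+ 2 + 2 * enorm (f 0 z) ^+ 2)).
    rewrite !sqr_enormc !mulr_sumr -big_split/=; apply: ler_sum => i _.
    rewrite !mxE -subr_ge0.
    have -> : 2 * (F i 0 - f 0 z i 0) ^+ 2 + 2 * f 0 z i 0 ^+ 2 - F i 0 ^+ 2
      = (F i 0 - 2 * f 0 z i 0) ^+ 2 by ring.
    exact: sqr_ge0.
  rewrite lerD// ler_wpM2l//.
    rewrite ler_pXn2r ?nnegrE ?enorm_ge0//.
    by apply: le_trans fyu; exact: enorm_ge0.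
  rewrite ler_pXn2r ?nnegrE ?enorm_ge0//.
  by apply: le_trans fz0; exact: enorm_ge0.
have -> : enorm (u + h *: F) ^+ 2
    = a ^+ 2 + 2 * h * edot u F + h ^+ 2 * enorm F ^+ 2.
  rewrite /a !sqr_enormc /edot !mulr_sumr -!big_split/=.
  by apply: eq_bigr => i _; rewrite !mxE; ring.
have e1 : 2 * h * edot u F <= h * (- 2 * mu * a ^+ 2 + 2 * (a * (Lz * b))).
  have -> : 2 * h * edot u F = h * (2 * edot u F) by ring.
  by rewrite ler_pM2l//; lra.
have e2 : 2 * h ^+ 2 * enorm F ^+ 2
    <= h * (mu / 2 * a ^+ 2) + h * (1 / 4 * b ^+ 2).
  apply: (@le_trans _ _ (2 * h ^+ 2 *
      (2 * (Ly * (1 + rho) * a) ^+ 2 + 2 * (Lz * b) ^+ 2))).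
    by rewrite ler_wpM2l// mulr_ge0// sqr_ge0.
  have -> : 2 * h ^+ 2 * (2 * (Ly * (1 + rho) * a) ^+ 2 + 2 * (Lz * b) ^+ 2)
     = h * ((4 * (h * Ly ^+ 2 * (1 + rho) ^+ 2)) * a ^+ 2)
       + h * ((4 * (h * Lz ^+ 2)) * b ^+ 2) by ring.
  rewrite lerD// ler_pM2l// ler_wpM2r ?sqr_ge0//.
    have rho2 : (1 + rho) ^+ 2 <= 2 * (1 + rho ^+ 2).
      by rewrite -subr_ge0 (_ : _ - _ = (1 - rho) ^+ 2) ?sqr_ge0//; ring.
    have : h * Ly ^+ 2 * (1 + rho) ^+ 2 <= h * Ly ^+ 2 * (2 * (1 + rho ^+ 2)).
      by rewrite ler_wpM2l// mulr_ge0 ?sqr_ge0// ltW.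
    lra.
  have : h * (8 * Lz ^+ 2) <= h * mu by rewrite ler_pM2l.
  lra.
have e3 : h * (2 * (a * (Lz * b))) <= h * (mu / 2 * a ^+ 2 + 1 / 4 * b ^+ 2).
  rewrite ler_pM2l//.
  have : 0 <= (2 * Lz * a - b / 2) ^+ 2 by exact: sqr_ge0.
  have : 8 * Lz ^+ 2 * a ^+ 2 <= mu * a ^+ 2 by rewrite ler_wpM2r ?sqr_ge0.
  lra.
lra.
Qed.

(** The conditional estimate before taking means: each sum in the second group
   consists of products of a term X - E[X | G] with a function of (y, z), and so
   is centred when y, z and the arguments of the conditional expectations are
   those of the scheme. *)
Lemma one_step_algebra n d (y u F : 'cV[R]_n) (z : 'M[R]_(n, d))
    (eta : 'cV[R]_d) (h L : R) : 0 < h -> L <= 1 ->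
  enorm y ^+ 2 <=
    (enorm (u + h *: F) ^+ 2 + h ^+ 2 * enorm F ^+ 2 - h / 2 * enorm z ^+ 2)
    + (\sum_k ((u + h *: F) k 0 - y k 0) * (- 2 * y k 0)
       + \sum_k \sum_j ((u *m eta^T) k j - z k j) * (- h * z k j)
       + \sum_k \sum_j (eta j 0 - 0) * (h * (y k 0 * z k j))
       + \sum_k \sum_j \sum_l ((eta *m eta^T) j l - (L * h^-1)%:M j l)
            * (h ^+ 2 / 2 * (z k j * z k l))).
Proof.
move=> h0 L1.
pose w := z *m eta.
have wE k : w k 0 = \sum_j z k j * eta j 0 by rewrite mxE.
have E2 : \sum_k \sum_j ((u *m eta^T) k j - z k j) * (- h * z k j)
    = - h * \sum_k u k 0 * w k 0 + h * enorm z ^+ 2.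
  rewrite sqr_enorm !mulr_sumr -big_split/=; apply: eq_bigr => k _.
  rewrite wE !mulr_sumr -big_split/=; apply: eq_bigr => j _.
  by rewrite !mxE big_ord1 !mxE; ring.
have E3 : \sum_k \sum_j (eta j 0 - 0) * (h * (y k 0 * z k j))
    = h * \sum_k y k 0 * w k 0.
  rewrite mulr_sumr; apply: eq_bigr => k _.
  by rewrite wE !mulr_sumr; apply: eq_bigr => j _; ring.
have E4 : \sum_k \sum_j \sum_l ((eta *m eta^T) j l - (L * h^-1)%:M j l)
            * (h ^+ 2 / 2 * (z k j * z k l))
    = h ^+ 2 / 2 * (enorm w ^+ 2) - h * L / 2 * enorm z ^+ 2.
  rewrite sqr_enormc sqr_enorm !mulr_sumr -sumrB; apply: eq_bigr => k _.
  rewrite wE (expr2 (\sum_j _)) mulr_suml !mulr_sumr -sumrB; apply: eq_bigr => j _.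
  have -> : h * L / 2 * z k j ^+ 2
      = \sum_l (L * h^-1)%:M j l * (h ^+ 2 / 2 * (z k j * z k l)).
    rewrite (bigD1 j)//= big1 ?addr0 => [|l lj].
      by rewrite mxE eqxx mulr1n; field; rewrite gt_eqF.
    by rewrite mxE eq_sym (negbTE lj) mulr0n mul0r.
  rewrite !mulr_sumr -sumrB; apply: eq_bigr => l _.
  by rewrite !mxE big_ord1 !mxE; ring.
rewrite E2 E3 E4.
have zL : h * L / 2 * enorm z ^+ 2 <= h / 2 * enorm z ^+ 2.
  rewrite ler_wpM2r ?sqr_ge0// ler_pM2r ?invr_gt0//.
  by rewrite -[leRHS]mulr1 ler_pM2l.
suff : enorm y ^+ 2 <= enorm (u + h *: F) ^+ 2 + h ^+ 2 * enorm F ^+ 2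
    + \sum_k ((u + h *: F) k 0 - y k 0) * (- 2 * y k 0)
    + - h * \sum_k u k 0 * w k 0 + h * \sum_k y k 0 * w k 0
    + h ^+ 2 / 2 * enorm w ^+ 2 by lra.
rewrite !sqr_enormc !mulr_sumr -!big_split/=; apply: ler_sum => k _.
(* With w = z eta, the difference is, entry by entry, the half sum of the
   squares of u - y + 2 h F and u - y - h w. *)
rewrite -subr_ge0 !mxE; set U := u k 0; set G := F k 0; set y' := y k 0.
rewrite [leRHS](_ : _ = 2^-1 * (U + 2 * h * G - y') ^+ 2
  + 2^-1 * (U - y' - h * (\sum_j z k j * eta j 0)) ^+ 2); last by field.
by rewrite addr_ge0// mulr_ge0// ?sqr_ge0.
Qed.

End Euclidean.

(** * Measurability *)

Section GeneratedMeasurability.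
Context {R : realType} {disp : measure_display} {Omega : measurableType disp}.
Implicit Types (G : set (set Omega)) (phi psi : Omega -> R).

(** Measurability with respect to the sigma-algebra generated by G, phrased
   through the measurable type that carries it so that the closure properties
   of measurable functions apply. *)
Definition gmeasurable G phi : Prop :=
  measurable_fun [set: g_sigma_algebraType G]
    (phi : g_sigma_algebraType G -> R).

Lemma wrtP G p q (X : Omega -> 'M[R]_(p, q)) :
  wrt <<s G>> X <-> forall i j, gmeasurable G (fun w => X w i j).
Proof.
split=> [GX i j _ B mB|GX i j B mB].
  by rewrite setTI; exact: GX.
by have := GX i j measurableT B mB; rewrite setTI.
Qed.

Lemma gmeasurable_measurable G phi : <<s G>> `<=` measurable ->
  gmeasurable G phi -> measurable_fun [set: Omega] phi.
Proof.
move=> mG Gphi _ B mB; rewrite setTI; apply: mG.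
by have := Gphi measurableT B mB; rewrite setTI.
Qed.

End GeneratedMeasurability.

Section LipschitzMeasurable.
Context {R : realType} {disp : measure_display} {Omega : measurableType disp}.

Lemma measurable_enorm p q (X : Omega -> 'M[R]_(p, q)) :
  random_mx X -> measurable_fun [set: Omega] (fun w => enorm (X w)).
Proof.
move=> mX; apply: (measurableT_comp (f := @Num.sqrt R)) => //.
  apply: continuous_measurable_fun; exact: sqrt_continuous.
apply: measurable_sum => i; apply: measurable_sum => j.
exact: measurable_funX.
Qed.

Lemma rational_approximation p q (x : 'M[R]_(p, q)) (e : R) : 0 < e ->
  exists r : 'M[rat]_(p, q), enorm (x - map_mx ratr r) < e.
Proof.
move=> e0; pose del := e / (p * q).+1%:R.
have del0 : 0 < del by rewrite divr_gt0.
have r_ i j : {r : rat | `|x i j - ratr r| <= del}.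
  apply: cid.
  have [|r] := @rat_in_itvoo R (x i j - del) (x i j + del); first by lra.
  rewrite in_itv/= => /andP[r1 r2]; exists r.
  by rewrite ler_norml; apply/andP; split; lra.
exists (\matrix_(i, j) sval (r_ i j)).
rewrite -(@ltr_pXn2r _ 2) ?nnegrE ?enorm_ge0 ?(ltW e0)//.
apply: (@le_lt_trans _ _ ((p * q)%:R * del ^+ 2)).
  by apply: enorm_le_bound => i j; rewrite !mxE; exact: (svalP (r_ i j)).
rewrite /del expr_div_n mulrA ltr_pdivrMr ?exprn_gt0// mulrC ltr_pM2l ?exprn_gt0//.
rewrite -natrX ltr_nat; apply: (@leq_trans (p * q).+1) => //.
by rewrite -[X in (X <= _)%N]expn1 leq_pexp2l.
Qed.

(** A Lipschitz function composed with a random vector is an infimum of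
   countably many random variables phi q + K |X - q|, for rational points q;
   here in terms of the sublevel sets. *)
Lemma measurable_lipschitz p q (phi : 'M[R]_(p, q) -> R) (K : R)
    (X : Omega -> 'M[R]_(p, q)) :
  (forall x y, `|phi x - phi y| <= K * enorm (x - y)) -> random_mx X ->
  measurable_fun [set: Omega] (fun w => phi (X w)).
Proof.
move=> phiK mX.
pose r_ (k : nat) : 'M[R]_(p, q) :=
  map_mx ratr (odflt (0 : 'M[rat]_(p, q)) (unpickle k)).
pose psi k w := phi (r_ k) + K * enorm (X w - r_ k).
have mpsi k : measurable_fun setT (psi k).
  apply: measurable_funD => //; apply: measurable_funM => //.
  by apply: measurable_enorm => i j; under eq_fun do rewrite !mxE;
    exact: measurable_funB.
move=> mD.
apply: (measurability _ (RGenInftyO.measurableE R)) => //.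
move=> _ [_ [a ->] <-].
rewrite (_ : _ `&` _ = \bigcup_k (setT `&` psi k @^-1` `]-oo, a[)).
  by apply: bigcup_measurable => k _; apply: mpsi.
apply/seteqP; split=> w /=; last first.
  move=> [k _ [_]]; rewrite /= !in_itv/= => ka; split => //.
  apply: le_lt_trans ka; rewrite /psi.
  have := phiK (X w) (r_ k); rewrite ler_norml => /andP[_]; lra.
move=> [_]; rewrite in_itv/= => wa.
pose e := (a - phi (X w)) / (2 * `|K| + 1).
have K1 : 0 < 2 * `|K| + 1 by rewrite ltr_wpDl// mulr_ge0.
have e0 : 0 < e by rewrite divr_gt0// subr_gt0.
have [r re] := rational_approximation (X w) e0.
have rE : r_ (pickle r) = map_mx ratr r by rewrite /r_ pickleK.
exists (pickle r) => //; split => //=; rewrite in_itv/= /psi rE.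
set y := map_mx ratr r in re *.
have := phiK (X w) y; rewrite ler_norml => /andP[+ _] => H1.
have nn := enorm_ge0 (X w - y).
have H2 : K * enorm (X w - y) <= `|K| * enorm (X w - y).
  by rewrite ler_wpM2r// ler_norm.
have H3 : `|K| * enorm (X w - y) <= `|K| * e by rewrite ler_wpM2l// ltW.
have H4 : (2 * `|K| + 1) * e = a - phi (X w) by rewrite /e mulrC divfK// gt_eqF.
lra.
Qed.

Lemma random_mx_lipschitz p q p' q' (F : 'M[R]_(p, q) -> 'M[R]_(p', q')) (K : R)
    (X : Omega -> 'M[R]_(p, q)) :
  (forall x y, enorm (F x - F y) <= K * enorm (x - y)) -> random_mx X ->
  random_mx (fun w => F (X w)).
Proof.
move=> FK mX i j.
apply: (measurable_lipschitz (K := K) (phi := fun A => F A i j)) => // x y.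
apply: le_trans (FK x y); have := normr_entry_le (F x - F y) i j.
by rewrite !mxE.
Qed.

End LipschitzMeasurable.

(** * Centred random variables and bounded test functions *)

Section Centred.
Context {R : realType} {disp : measure_display} {Omega : measurableType disp}.
Variable P : probability Omega R.
Implicit Types (D V phi psi : Omega -> R) (G : set (set Omega)).

Definition integrable_fun D := P.-integrable [set: Omega] (EFin \o D).

Definition centred D := integrable_fun D /\ (\int[P]_w (D w)%:E = 0)%E.

Definition centred_on G D := integrable_fun D /\
  forall A, <<s G>> A -> (\int[P]_(w in A) (D w)%:E = 0)%E.

Lemma integrable_fun_measurable D :
  integrable_fun D -> measurable_fun [set: Omega] D.
Proof. by move=> /measurable_int /measurable_EFinP. Qed.

Lemma centredD D D' : centred D -> centred D' -> centred (fun w => D w + D' w).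
Proof.
move=> [iD eD] [iD' eD']; split.
  by have := integrableD measurableT iD iD'; apply: eq_integrable.
have := integralD_EFin measurableT iD iD'; rewrite /= eD eD' adde0.
by move=> <-.
Qed.

Lemma centredZ D (c : R) : centred D -> centred (fun w => c * D w).
Proof.
move=> [iD eD]; split.
  by have := integrableZl measurableT c iD; apply: eq_integrable.
have := integralZl measurableT iD c; rewrite /= eD mule0 => <-.
by under eq_integral do rewrite EFinM.
Qed.

Lemma centred_sum (I : Type) (r : seq I) (F : I -> Omega -> R) :
  (forall i, centred (F i)) -> centred (fun w => \sum_(i <- r) F i w).
Proof.
move=> cF; elim: r => [|i r IH].
  under [in X in centred X]eq_fun do rewrite big_nil.
  by split; [exact: integrable0|rewrite integral0].
under [in X in centred X]eq_fun do rewrite big_cons.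
exact: centredD.
Qed.

Lemma eq_centred D D' : D =1 D' -> centred D -> centred D'.
Proof. by move=> /funext ->. Qed.

Lemma patch_indic phi (A : set Omega) :
  (EFin \o phi) \_ A = (fun w => (phi w * \1_A w)%:E).
Proof.
apply/funext => w; rewrite patchE indicE; case: ifPn => _.
  by rewrite mulr1.
by rewrite mulr0.
Qed.

Lemma centred_indic G D A : <<s G>> `<=` measurable -> centred_on G D ->
  <<s G>> A -> centred (fun w => D w * \1_A w).
Proof.
move=> mG [iD eD] GA; have mA : measurable A by exact: mG.
split.
  rewrite /integrable_fun (_ : _ \o _ = (EFin \o D) \_ A); last by rewrite patch_indic.
  have iDA := integrableS measurableT mA (@subsetT _ A) iD.
  exact: (iffLR (integrable_mkcond _ mA) iDA).
transitivity (\int[P]_w ((EFin \o D) \_ A) w)%E; first by rewrite patch_indic.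
by rewrite -integral_mkcond; exact: eD.
Qed.

(** For v in [0, K e], the sum is v rounded up to a multiple of e; as a
   function of v it is a combination of indicators. *)
Lemma staircase_bounds (e v : R) (K : nat) : 0 <= e -> 0 <= v <= K%:R * e ->
  `|v - \sum_(j < K) e * (j%:R * e < v)%R%:R| <= e.
Proof.
move=> e0 /andP[v0 vK].
suff [H1 H2] : (K%:R * e < v -> \sum_(j < K) e * (j%:R * e < v)%R%:R = K%:R * e) /\
    (v <= K%:R * e -> `|v - \sum_(j < K) e * (j%:R * e < v)%R%:R| <= e).
  exact: H2.
elim: K {vK} => [|K [IH1 IH2]].
  rewrite mul0r big_ord0; split=> // v0'.
  by rewrite (_ : v = 0) ?subr0 ?normr0//; apply/le_anti; rewrite v0 v0'.
rewrite big_ord_recr/= -natr1; split => [Kv|vK].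
  have Kv' : K%:R * e < v by lra.
  by rewrite IH1// Kv' mulr1 mulrDl mul1r.
have [Kv|Kv] := ltP (K%:R * e) v.
  rewrite IH1// mulr1 ler_norml; apply/andP; split; lra.
by rewrite mulr0 addr0; exact: IH2.
Qed.

Lemma integrable_funM D V (M : R) : integrable_fun D ->
  measurable_fun [set: Omega] V -> (forall w, `|V w| <= M) ->
  integrable_fun (fun w => D w * V w).
Proof.
move=> iD mV VM.
have iMD : P.-integrable setT (fun w => M%:E * (EFin \o D) w)%E.
  exact: integrableZl.
apply: le_integrable iMD => //.
  apply/measurable_EFinP; apply: measurable_funM => //.
  exact: integrable_fun_measurable.
move=> w _ /=; rewrite lee_fin !normrM mulrC ler_wpM2r//.
by apply: le_trans (VM w) _; rewrite ler_norm.
Qed.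

(** A random variable with zero integral on each event of a sigma-algebra is
   orthogonal to every bounded V measurable for it: V is within e of a finite
   combination of indicators, for every e > 0. *)
Lemma centred_test G D V (M : R) : <<s G>> `<=` measurable ->
  centred_on G D -> gmeasurable G V -> (forall w, `|V w| <= M) ->
  centred (fun w => D w * V w).
Proof.
move=> mG cD GV VM; have [iD eD] := cD.
have mV := gmeasurable_measurable mG GV.
have iDV := integrable_funM iD mV VM.
split=> //.
have iaD : P.-integrable setT (abse \o (EFin \o D)) by exact: integrable_abse.
have cfin : (\int[P]_w `|(D w)%:E|)%E \is a fin_num.
  by have := integrable_fin_num measurableT iaD.
pose c := fine (\int[P]_w `|(D w)%:E|)%E.
have c0 : 0 <= c by rewrite fine_ge0// integral_ge0.
have Ifin : (\int[P]_w (D w * V w)%:E)%E \is a fin_num.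
  exact: (integrable_fin_num measurableT iDV).
pose I := fine (\int[P]_w (D w * V w)%:E)%E.
suff Ie e : 0 < e -> `|I| <= e * c.
  rewrite -(fineK Ifin) -/I; congr (_%:E); apply/eqP/negP => /negP I0.
  have I0' : 0 < `|I| by rewrite normr_gt0.
  have := Ie (`|I| / (2 * (c + 1))).
  rewrite divr_gt0//; last by rewrite mulr_gt0// ltr_wpDl.
  move=> /(_ isT); rewrite mulrAC ler_pdivlMr; last by rewrite mulr_gt0// ltr_wpDl.
  rewrite ler_pM2l//; lra.
move=> e0.
have M0 : 0 <= M.
  by apply: le_trans (VM point); rewrite normr_ge0.
pose K := (Num.truncn (2 * M / e)).+1.
have KM : 2 * M <= K%:R * e.
  by rewrite -ler_pdivrMr// ltW// /K truncnS_gt.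
pose v w := V w + M.
have v0 w : 0 <= v w <= K%:R * e.
  have := VM w; rewrite ler_norml => /andP[? ?].
  by rewrite /v; apply/andP; split; lra.
pose A (j : nat) := [set w | j%:R * e < v w].
have GA j : <<s G>> (A j).
  have := GV measurableT `]j%:R * e - M, +oo[%classic (measurable_itv _).
  rewrite setTI (_ : _ @^-1` _ = A j)//.
  by apply/seteqP; split=> w; rewrite /A /v /= in_itv/= andbT => ?; lra.
pose s w := \sum_(j < K) e * (j%:R * e < v w)%R%:R.
have cDs : centred (fun w => D w * s w).
  have : centred (fun w => \sum_(j < K) e * (D w * \1_(A j) w)).
    by apply: centred_sum => j; apply: centredZ; exact: (centred_indic mG).
  apply: eq_centred => w; rewrite /s mulr_sumr; apply: eq_bigr => j _.
  rewrite indicE mulrCA; congr (_ * (_ * _%:R)).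
  by rewrite /A mem_setE.
have ms : measurable_fun setT s.
  apply: measurable_sum => j; apply: measurable_funM => //.
  rewrite (_ : (fun _ => _) = \1_(A j)).
    by apply: measurable_indic; exact: mG.
  by apply/funext => w; rewrite indicE /A mem_setE.
have vs w : `|v w - s w| <= e by apply: staircase_bounds; rewrite ?(ltW e0).
have mvs : measurable_fun setT (fun w => v w - s w).
  by apply: measurable_funB => //; apply: measurable_funD.
have iDvs : integrable_fun (fun w => D w * (v w - s w)).
  exact: integrable_funM vs.
have c1 : centred (fun w => D w * s w + (- M) * D w).
  apply: centredD => //; apply: centredZ; split=> //; apply: eD.
  exact: (@measurableT _ (g_sigma_algebraType G)).
have IE : (\int[P]_w (D w * V w)%:E = \int[P]_w (D w * (v w - s w))%:E)%E.
  have [ic1 ec1] := c1.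
  have := integralD_EFin measurableT iDvs ic1; rewrite /= ec1 adde0 => <-.
  by apply: eq_integral => w _ /=; rewrite -EFinD; congr (_%:E); rewrite /v; ring.
rewrite -lee_fin /I EFinM /c fineK// -fine_abse// fineK ?abse_fin_num// IE.
apply: le_trans (le_abse_integral _ measurableT _) _ => //.
  exact: (measurable_int _ iDvs).
rewrite -ge0_integralZl ?lee_fin ?(ltW e0)//; last exact: (measurable_int P iaD).
apply: ge0_le_integral => //.
- exact: (measurableT_comp _ (measurable_int _ iDvs)).
- by apply: measurable_funeM; exact: (measurable_int _ iaD).
- move=> w _ /=; rewrite lee_fin normrM mulrC ler_wpM2r//.
Qed.

(** Monotone convergence along the sublevel sets of psi, which increase to the
   whole space. *)
Lemma integral_le_sublevel psi phi (L : \bar R) :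
  measurable_fun [set: Omega] psi -> measurable_fun [set: Omega] phi ->
  (forall w, 0 <= phi w) ->
  (forall k : nat,
     (\int[P]_w (phi w * \1_[set w' | psi w' <= k%:R] w)%:E <= L)%E) ->
  (\int[P]_w (phi w)%:E <= L)%E.
Proof.
move=> mpsi mphi phi0 HL.
pose B (k : nat) := [set w | psi w <= k%:R].
have mB k : measurable (B k).
  have := mpsi measurableT `]-oo, k%:R]%classic (measurable_itv _); rewrite setTI.
  by rewrite (_ : _ @^-1` _ = B k)//; apply/seteqP; split=> w; rewrite /= in_itv.
have BT : \bigcup_k B k = setT.
  apply/seteqP; split=> // w _; exists (Num.truncn (psi w)).+1 => //.
  by apply/ltW; rewrite truncnS_gt.
have ndB : nondecreasing_seq B.
  move=> k l kl; apply/subsetPset => w /= /le_trans; apply.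
  by rewrite ler_nat.
have mf k : measurable_fun (B k) (EFin \o phi).
  by apply/measurable_EFinP; exact: measurable_funS mphi.
have f0 k w : B k w -> (0 <= (EFin \o phi) w)%E by rewrite /= lee_fin.
have := ge0_nondecreasing_set_cvg_integral (mu := P) ndB mB mf f0.
rewrite BT => H; rewrite -(cvg_lim _ H)//.
apply: lime_le; first by apply/cvg_ex; eexists; exact: H.
apply: nearW => k; have := HL k; rewrite integral_mkcond; congr (_ <= _)%E.
apply: eq_integral => w _; rewrite patchE indicE /=.
by case: ifPn => _; rewrite ?mulr1 ?mulr0.
Qed.

End Centred.

(** * Conditional expectation: the one-step estimate *)

Section OneStep.
Context {R : realType} {disp : measure_display} {Omega : measurableType disp}.
Variable P : probability Omega R.
Implicit Types (G : set (set Omega)) (B : set Omega).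

Lemma condexp_centred_on G p q (X E : Omega -> 'M[R]_(p, q)) i j :
  <<s G>> `<=` measurable -> is_condexp P <<s G>> X E ->
  centred_on P G (fun w => X w i j - E w i j).
Proof.
move=> mG [_ /(_ i j)[iX iE eXE]]; split.
  by have := integrableB measurableT iX iE; apply: eq_integrable.
move=> A GA; have mA : measurable A by exact: mG.
have iXA := integrableS measurableT mA (@subsetT _ A) iX.
have iEA := integrableS measurableT mA (@subsetT _ A) iE.
transitivity (\int[P]_(w in A) ((X w i j)%:E - (E w i j)%:E))%E.
  by apply: eq_integral => w _; rewrite EFinB.
rewrite integralB_EFin// eXE// subee//.
exact: (integrable_fin_num mA iEA).
Qed.

(** The test function V may be unbounded, and X V may fail to be integrable:
   the defining property of the conditional expectation is used on an event of
   the sigma-algebra on which V is bounded. *)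
Lemma condexp_test G p q (X E : Omega -> 'M[R]_(p, q)) i j B
    (V : Omega -> R) (M : R) :
  <<s G>> `<=` measurable -> is_condexp P <<s G>> X E ->
  <<s G>> B -> gmeasurable G V -> (forall w, B w -> `|V w| <= M) ->
  centred P (fun w => (X w i j - E w i j) * (\1_B w * V w)).
Proof.
move=> mG XE GB GV VM.
apply: (centred_test (M := `|M|) mG (condexp_centred_on i j mG XE)).
  by apply: measurable_funM => //; exact: measurable_indic.
move=> w; rewrite indicE; case: (boolP (w \in B)) => [|_]; last by rewrite mul0r normr0.
by rewrite inE => /VM Vw; rewrite mul1r (le_trans Vw)// ler_norm.
Qed.

Lemma gmeasurable_sublevel G (psi : Omega -> R) (a : R) :
  gmeasurable G psi -> <<s G>> [set w | psi w <= a].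
Proof.
move=> /(_ measurableT `]-oo, a]%classic (measurable_itv _)).
by rewrite setTI (_ : _ @^-1` _ = [set w | psi w <= a]).
Qed.

Lemma integrable_bounded (phi : Omega -> R) (M : R) :
  measurable_fun [set: Omega] phi -> (forall w, `|phi w| <= M) ->
  integrable_fun P phi.
Proof.
move=> mphi phiM.
have i1 : integrable_fun P (fun=> 1) by exact: finite_measure_integrable_cst.
have := integrable_funM i1 mphi phiM.
by rewrite (_ : (fun w => 1 * phi w) = phi)//; apply/funext => w; rewrite mul1r.
Qed.

(** Here y = E[u + h F | G] and z = E[u eta^T | G], where the weight eta has
   conditional mean zero and conditional covariance (L / h) I. In mean, |y|^2
   is |u + h F|^2 minus |u + h F - y|^2. Jensen's inequality would drop the
   subtracted square. It is kept, because h |z|^2 is bounded in mean by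
   |u - y|^2 (Bessel's inequality against the components of eta, L <= 1), hence
   by 2 |u + h F - y|^2 + 2 h^2 |F|^2: the subtracted square provides the
   term - (h / 2) |z|^2 with which the dependence of a driver on z is
   controlled. The identities in mean hold on the events where
   |y| + |z| <= k, and monotone convergence in k concludes. *)
Lemma condexp_step_le G n d (u F y : Omega -> 'cV[R]_n)
    (z : Omega -> 'M[R]_(n, d)) (eta : Omega -> 'cV[R]_d) (h L a r : R) :
  <<s G>> `<=` measurable -> 0 < h -> L <= 1 -> 0 <= a ->
  random_mx u -> (forall w, enorm (u w) <= r) ->
  is_condexp P <<s G>> (fun w => u w *m (eta w)^T) z ->
  is_condexp P <<s G>> (fun w => u w + h *: F w) y ->
  is_condexp P <<s G>> eta (fun=> 0) ->
  is_condexp P <<s G>> (fun w => eta w *m (eta w)^T) (fun=> (L * h^-1)%:M) ->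
  (forall w, enorm (u w + h *: F w) ^+ 2 + h ^+ 2 * enorm (F w) ^+ 2
    - h / 2 * enorm (z w) ^+ 2 <= a * enorm (u w) ^+ 2) ->
  (\int[P]_w (enorm (y w) ^+ 2)%:E <= a%:E * \int[P]_w (enorm (u w) ^+ 2)%:E)%E.
Proof.
move=> mG h0 L1 a0 mu ur Hz Hy He Hee HF.
have Gy i j : gmeasurable G (fun w => y w i j) by case: Hy => /wrtP.
have Gz i j : gmeasurable G (fun w => z w i j) by case: Hz => /wrtP.
pose psi w := enorm (y w) + enorm (z w).
have Gpsi : gmeasurable G psi.
  apply: measurable_funD.
    exact: (@measurable_enorm _ _ (g_sigma_algebraType G)).
  exact: (@measurable_enorm _ _ (g_sigma_algebraType G)).
have my : measurable_fun setT (fun w => enorm (y w) ^+ 2).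
  by apply: measurable_funX; apply: measurable_enorm => i j;
    exact: (gmeasurable_measurable mG).
have mu2 : measurable_fun setT (fun w => enorm (u w) ^+ 2).
  by apply: measurable_funX; exact: measurable_enorm.
have iu2 : integrable_fun P (fun w => a * enorm (u w) ^+ 2).
  apply: (@integrable_bounded _ (a * r ^+ 2)); first exact: measurable_funM.
  move=> w; rewrite normrM (ger0_norm a0) ler_wpM2l// ger0_norm ?sqr_ge0//.
  rewrite ler_pXn2r ?nnegrE ?enorm_ge0//.
  by apply: le_trans (ur w); exact: enorm_ge0.
apply: (integral_le_sublevel (psi := psi)) => //.
- exact: (gmeasurable_measurable mG).
- by move=> w; rewrite sqr_ge0.
move=> k; set B := [set w | _].
have GB : <<s G>> B by exact: gmeasurable_sublevel.
have yB i j w : B w -> `|y w i j| <= k%:R.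
  rewrite /B/= /psi; have := normr_entry_le (y w) i j.
  by have := enorm_ge0 (z w); lra.
have zB i j w : B w -> `|z w i j| <= k%:R.
  rewrite /B/= /psi; have := normr_entry_le (z w) i j.
  by have := enorm_ge0 (y w); lra.
pose M w :=
  \sum_i ((u w + h *: F w) i 0 - y w i 0) * (\1_B w * (- 2 * y w i 0))
  + \sum_i \sum_j ((u w *m (eta w)^T) i j - z w i j) * (\1_B w * (- h * z w i j))
  + \sum_i \sum_j (eta w j 0 - (0 : 'cV[R]_d) j 0)
      * (\1_B w * (h * (y w i 0 * z w i j)))
  + \sum_i \sum_j \sum_l ((eta w *m (eta w)^T) j l - (L * h^-1)%:M j l)
      * (\1_B w * (h ^+ 2 / 2 * (z w i j * z w i l))).
have cM : centred P M.
  apply: centredD; first apply: centredD; first apply: centredD.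
  - apply: centred_sum => i.
    apply: (condexp_test (M := 2 * k%:R) i 0 mG Hy GB).
      by apply: measurable_funM; [exact: measurable_cst|exact: Gy].
    by move=> w Bw; rewrite normrM normrN normr_nat ler_wpM2l// yB.
  - apply: centred_sum => i; apply: centred_sum => j.
    apply: (condexp_test (M := h * k%:R) i j mG Hz GB).
      by apply: measurable_funM; [exact: measurable_cst|exact: Gz].
    by move=> w Bw; rewrite normrM normrN (gtr0_norm h0) ler_wpM2l ?zB// ltW.
  - apply: centred_sum => i; apply: centred_sum => j.
    apply: (condexp_test (M := h * (k%:R * k%:R)) j 0 mG He GB).
      apply: measurable_funM; first exact: measurable_cst.
      by apply: measurable_funM; [exact: Gy|exact: Gz].
    move=> w Bw; rewrite normrM (gtr0_norm h0) ler_wpM2l ?(ltW h0)//.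
    by rewrite normrM ler_pM ?yB ?zB.
  - apply: centred_sum => i; apply: centred_sum => j; apply: centred_sum => l.
    apply: (condexp_test (M := h ^+ 2 / 2 * (k%:R * k%:R)) j l mG Hee GB).
      apply: measurable_funM; first exact: measurable_cst.
      by apply: measurable_funM; exact: Gz.
    have h2 : 0 <= h ^+ 2 / 2 by rewrite divr_ge0// sqr_ge0.
    move=> w Bw; rewrite normrM (ger0_norm h2) ler_wpM2l//.
    by rewrite normrM ler_pM ?zB.
have yM w : enorm (y w) ^+ 2 * \1_B w <= a * enorm (u w) ^+ 2 + M w.
  have := one_step_algebra (y w) (u w) (F w) (z w) (eta w) h0 L1.
  rewrite /M indicE; case: (boolP (w \in B)) => _ => [H|_]; last first.
    rewrite mulr0 !big1 ?addr0 => [|i _|i _|i _|i _].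
    - by rewrite mulr_ge0// sqr_ge0.
    - by rewrite big1// => j _; rewrite big1// => l _; rewrite mul0r mulr0.
    - by rewrite big1// => j _; rewrite mul0r mulr0.
    - by rewrite big1// => j _; rewrite mul0r mulr0.
    - by rewrite mul0r mulr0.
  rewrite mulr1; apply: le_trans H _; apply: lerD; first exact: HF.
  rewrite le_eqVlt; apply/orP; left; apply/eqP; congr (_ + _ + _ + _).
  - by apply: eq_bigr => i _; rewrite mul1r.
  - by apply: eq_bigr => i _; apply: eq_bigr => j _; rewrite mul1r.
  - by apply: eq_bigr => i _; apply: eq_bigr => j _; rewrite mul1r mxE.
  - apply: eq_bigr => i _; apply: eq_bigr => j _; apply: eq_bigr => l _.
    by rewrite mul1r.
have [iM eM] := cM.
rewrite -ge0_integralZl ?lee_fin//; last 2 first.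
- exact/measurable_EFinP.
- by move=> w _; rewrite lee_fin sqr_ge0.
have := integralD_EFin measurableT iu2 iM.
rewrite /= eM adde0.
under [X in _ = X -> _]eq_integral do rewrite EFinM.
move=> <-.
apply: ge0_le_integral => //.
- by move=> w _; rewrite lee_fin mulr_ge0 ?sqr_ge0.
- apply/measurable_EFinP; apply: measurable_funM => //.
  by apply: measurable_indic; exact: mG.
- by have := integrableD measurableT iu2 iM; apply: measurable_int.
- by move=> w _; rewrite lee_fin.
Qed.

End OneStep.

(** * Square integrability and independence *)

Section SquareIntegrable.
Context {R : realType} {disp : measure_display} {Omega : measurableType disp}.
Variable P : probability Omega R.
Implicit Types (phi psi a b : Omega -> R) (G : set (set Omega)).

Definition sqint phi := measurable_fun [set: Omega] phi /\
  integrable_fun P (fun w => phi w ^+ 2).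

Lemma sqint_le phi psi : measurable_fun [set: Omega] phi ->
  (forall w, `|phi w| <= `|psi w|) -> sqint psi -> sqint phi.
Proof.
move=> mphi le [_ ipsi]; split=> //.
apply: le_integrable ipsi => //.
  by apply/measurable_EFinP; exact: measurable_funX.
by move=> w _ /=; rewrite lee_fin !normrX ler_pXn2r ?nnegrE.
Qed.

Lemma sqint_cst (c : R) : sqint (fun=> c).
Proof. by split; [exact: measurable_cst|exact: finite_measure_integrable_cst]. Qed.

Lemma sqintZ (c : R) phi : sqint phi -> sqint (fun w => c * phi w).
Proof.
move=> [mphi iphi]; split; first exact: measurable_funM.
have := integrableZl measurableT (c ^+ 2) iphi; apply: eq_integrable => //.
by move=> w _ /=; rewrite -EFinM exprMn.
Qed.

Lemma sqintD phi psi : sqint phi -> sqint psi -> sqint (fun w => phi w + psi w).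
Proof.
move=> [mphi iphi] [mpsi ipsi].
have mD : measurable_fun setT (fun w => phi w + psi w) by exact: measurable_funD.
split=> //.
have i2 := integrableD measurableT
  (integrableZl measurableT 2 iphi) (integrableZl measurableT 2 ipsi).
apply: le_integrable i2 => //.
  by apply/measurable_EFinP; exact: measurable_funX.
move=> w _ /=; rewrite lee_fin ger0_norm ?sqr_ge0// ger0_norm; last first.
  by rewrite addr_ge0// mulr_ge0// sqr_ge0.
rewrite -subr_ge0 (_ : _ - _ = (phi w - psi w) ^+ 2) ?sqr_ge0//; ring.
Qed.

Lemma sqint_sum (I : Type) (r : seq I) (F : I -> Omega -> R) :
  (forall i, sqint (F i)) -> sqint (fun w => \sum_(i <- r) F i w).
Proof.
move=> sF; elim: r => [|i r IH].
  rewrite (_ : (fun _ => _) = fun=> 0); first exact: sqint_cst.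
  by apply/funext => w; rewrite big_nil.
rewrite (_ : (fun _ => _) = (fun w => F i w + \sum_(i <- r) F i w)).
  exact: sqintD.
by apply/funext => w; rewrite big_cons.
Qed.

Definition sqint_mx p q (X : Omega -> 'M[R]_(p, q)) :=
  forall i j, sqint (fun w => X w i j).

Lemma sqint_random_mx p q (X : Omega -> 'M[R]_(p, q)) : sqint_mx X -> random_mx X.
Proof. by move=> sX i j; case: (sX i j). Qed.

Lemma sqint_enorm p q (X : Omega -> 'M[R]_(p, q)) :
  sqint_mx X -> sqint (fun w => enorm (X w)).
Proof.
move=> sX; have mX := measurable_enorm (sqint_random_mx sX).
apply: (@sqint_le _ (fun w => \sum_i \sum_j `|X w i j|)) => //; last first.
  apply: sqint_sum => i; apply: sqint_sum => j.
  apply: (@sqint_le _ (fun w => X w i j)) (sX i j).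
    by apply: measurableT_comp => //; case: (sX i j).
  by move=> w; rewrite normr_id.
move=> w; rewrite ger0_norm ?enorm_ge0// ger0_norm; last first.
  by apply: sumr_ge0 => i _; exact: sumr_ge0.
set s := \sum_i _; have s0 : 0 <= s.
  by apply: sumr_ge0 => i _; exact: sumr_ge0.
rewrite -(@ler_pXn2r _ 2) ?nnegrE ?enorm_ge0// sqr_enorm expr2 {1}/s mulr_suml.
apply: ler_sum => i _; rewrite mulr_suml; apply: ler_sum => j _.
rewrite -real_normK ?num_real// expr2 ler_wpM2l//.
rewrite /s (bigD1 i)//= (bigD1 j)//= -addrA lerDl addr_ge0// ?sumr_ge0// => k _.
exact: sumr_ge0.
Qed.

Lemma sqint_lipschitz p q p' q' (F : 'M[R]_(p, q) -> 'M[R]_(p', q')) (K : R)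
    (X : Omega -> 'M[R]_(p, q)) :
  (forall x y, enorm (F x - F y) <= K * enorm (x - y)) -> sqint_mx X ->
  sqint_mx (fun w => F (X w)).
Proof.
move=> FK sX i j; have mF := random_mx_lipschitz FK (sqint_random_mx sX).
apply: (@sqint_le _ (fun w => `|F 0 i j| + K * enorm (X w))) => //; last first.
  by apply: sqintD; [exact: sqint_cst|apply: sqintZ; exact: sqint_enorm].
move=> w; apply: le_trans (ler_norm _).
have := FK (X w) 0; rewrite subr0 => H.
have := normr_entry_le (F (X w) - F 0) i j; rewrite !mxE => H'.
have := ler_normB (F (X w) i j - F 0 i j) (- F 0 i j).
rewrite opprK subrK normrN; lra.
Qed.

Lemma sqint_mx_lty p q (X : Omega -> 'M[R]_(p, q)) : sqint_mx X ->
  (\int[P]_w (enorm (X w) ^+ 2)%:E < +oo)%E.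
Proof.
move=> /sqint_enorm[_ iX]; have /integrableP[_] := iX.
by under eq_integral do rewrite /= ger0_norm ?sqr_ge0//.
Qed.

Lemma integral_centring phi : integrable_fun P phi ->
  centred P (fun w => phi w - fine (\int[P]_w' (phi w')%:E)).
Proof.
move=> iphi; set c := fine _.
have ic : integrable_fun P (fun=> c) by exact: finite_measure_integrable_cst.
split; first by have := integrableB measurableT iphi ic; apply: eq_integrable.
have := integralB_EFin measurableT iphi ic; rewrite /=.
under eq_integral do rewrite -EFinB; move=> ->.
rewrite integral_cst// [X in (_ * X)%E](probability_setT P) mule1.
by rewrite /c fineK ?subee//; exact: (integrable_fin_num measurableT iphi).
Qed.

(** Independence enters through the events of both sigma-algebras only; the
   testing lemma is applied once to the indicators of the first against a
   function of the second, and once the other way round. *)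
Lemma integralM_indep G1 G2 a b (M : R) :
  <<s G1>> `<=` measurable -> <<s G2>> `<=` measurable ->
  independent_systems P <<s G1>> <<s G2>> ->
  gmeasurable G1 a -> gmeasurable G2 b ->
  (forall w, `|a w| <= M) -> (forall w, `|b w| <= M) ->
  (\int[P]_w (a w * b w)%:E =
   \int[P]_w (a w)%:E * \int[P]_w (b w)%:E)%E.
Proof.
move=> mG1 mG2 ind Ga Gb aM bM.
have ma := gmeasurable_measurable mG1 Ga.
have mb := gmeasurable_measurable mG2 Gb.
have ia := integrable_bounded P ma aM; have ib := integrable_bounded P mb bM.
pose c := fine (\int[P]_w (b w)%:E)%E.
have cE : (\int[P]_w (b w)%:E)%E = c%:E.
  by rewrite /c fineK//; exact: (integrable_fin_num measurableT ib).
have cb : centred P (fun w => b w - c) := integral_centring ib.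
have indic_centred A : <<s G1>> A ->
    centred_on P G2 (fun w => \1_A w - fine (P A)).
  move=> GA; have mA : measurable A := mG1 _ GA.
  have i1 : integrable_fun P \1_A.
    by apply: integrable_indic => //; rewrite -ge0_fin_numE ?fin_num_measure.
  have [ic _] := integral_centring i1.
  rewrite integral_indic// setIT in ic.
  split=> // B GB; have mB : measurable B := mG2 _ GB.
  have icst : P.-integrable B (EFin \o cst (fine (P A))).
    exact: finite_measure_integrable_cst.
  have i1B := integrableS measurableT mB (@subsetT _ B) i1.
  transitivity (\int[P]_(w in B) ((\1_A w)%:E - (fine (P A))%:E))%E.
    by apply: eq_integral => w _; rewrite EFinB.
  rewrite integralB_EFin// integral_indic// integral_cst//.
  rewrite [X in (X - _)%E]ind// fineK ?fin_num_measure//.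
  by rewrite subee// fin_numM ?fin_num_measure.
have cb1 : centred_on P G1 (fun w => b w - c).
  split=> [|A GA]; first by case: cb.
  have mA : measurable A := mG1 _ GA.
  rewrite integral_mkcond patch_indic.
  have c1 := centred_test mG2 (indic_centred A GA) Gb bM.
  have c2 : centred P (fun w => \1_A w - fine (P A)).
    have [i12 e12] := indic_centred A GA; split=> //; apply: e12.
    exact: (@measurableT _ (g_sigma_algebraType G2)).
  have c3 := centredD c1 (centredD (centredZ (fine (P A)) cb) (centredZ (- c) c2)).
  have [_ <-] := c3; apply: eq_integral => w _; congr (_%:E); ring.
have [icab ecab] := centred_test mG1 cb1 Ga aM.
have ica := integrableZl measurableT c ia.
have := integralD measurableT icab ica; rewrite /= ecab add0e.
rewrite (integralZl measurableT ia) cE muleC => <-.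
by apply: eq_integral => w _; rewrite /= -EFinM -EFinD; congr (_%:E); ring.
Qed.

(** Both factors are truncated first, which puts the product formula for bounded
   functions within reach, and the bound passes to the limit. *)
Lemma sqintM_indep G1 G2 phi psi :
  <<s G1>> `<=` measurable -> <<s G2>> `<=` measurable ->
  independent_systems P <<s G1>> <<s G2>> ->
  gmeasurable G1 phi -> gmeasurable G2 psi -> sqint phi -> sqint psi ->
  sqint (fun w => phi w * psi w).
Proof.
move=> mG1 mG2 ind G1phi G2psi [mphi iphi] [mpsi ipsi].
have mM : measurable_fun setT (fun w => (phi w * psi w) ^+ 2).
  by apply: measurable_funX; exact: measurable_funM.
split; first exact: measurable_funM.
have fin (f : Omega -> R) : integrable_fun P (fun w => f w ^+ 2) ->
    (\int[P]_w (f w ^+ 2)%:E)%E \is a fin_num.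
  by move=> i; exact: (integrable_fin_num measurableT i).
apply/integrableP; split; first exact/measurable_EFinP.
apply: (@le_lt_trans _ _
    (\int[P]_w (phi w ^+ 2)%:E * \int[P]_w (psi w ^+ 2)%:E)%E); last first.
  by rewrite ltey_eq fin_numM// fin.
under eq_integral do rewrite /= ger0_norm ?sqr_ge0//.
pose s w := phi w ^+ 2 + psi w ^+ 2.
apply: (@integral_le_sublevel _ _ _ P s) => //.
- by apply: measurable_funD; exact: measurable_funX.
- by move=> w; rewrite sqr_ge0.
move=> k.
pose A (f : Omega -> R) := [set w | f w ^+ 2 <= k%:R].
pose trunc (f : Omega -> R) w : R := f w ^+ 2 * \1_(A f) w.
have trunc_g G f : gmeasurable G f -> gmeasurable G (trunc f).
  move=> Gf; have Gf2 : gmeasurable G (fun w => f w ^+ 2).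
    exact: measurable_funX.
  apply: measurable_funM => //; apply: measurable_indic.
  exact: (gmeasurable_sublevel k%:R Gf2).
have trunc0 f w : 0 <= trunc f w by rewrite mulr_ge0 ?sqr_ge0.
have trunck f w : `|trunc f w| <= k%:R.
  rewrite ger0_norm// /trunc indicE; case: (boolP (w \in A f)) => [|_].
    by rewrite inE/= mulr1.
  by rewrite mulr0.
have trunc_le f w : trunc f w <= f w ^+ 2.
  rewrite /trunc indicE -[leRHS]mulr1 ler_wpM2l ?sqr_ge0//.
  by rewrite lern1; case: (w \in A f).
have gphi := trunc_g _ _ G1phi; have gpsi := trunc_g _ _ G2psi.
have mphi' := gmeasurable_measurable mG1 gphi.
have mpsi' := gmeasurable_measurable mG2 gpsi.
set S := [set w | _].
have msub : measurable S.
  rewrite (_ : S = s @^-1` `]-oo, k%:R]).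
    have : measurable_fun setT s by apply: measurable_funD; exact: measurable_funX.
    by move=> /(_ measurableT `]-oo, k%:R]%classic (measurable_itv _));
      rewrite setTI.
  by apply/seteqP; split=> w; rewrite /= in_itv.
apply: (@le_trans _ _ (\int[P]_w (trunc phi w * trunc psi w)%:E)%E).
  apply: ge0_le_integral => //.
  - by move=> w _; rewrite lee_fin mulr_ge0 ?sqr_ge0.
  - apply/measurable_EFinP; apply: measurable_funM; first exact: mM.
    by apply: measurable_indic.
  - by apply/measurable_EFinP; exact: measurable_funM.
  - move=> w _; rewrite lee_fin indicE; case: (boolP (w \in S)) => [|_].
      rewrite inE/= /s mulr1 /trunc !indicE => sk.
      rewrite !mem_set/A/= ?mulr1 ?exprMn//; apply: le_trans sk.
        by rewrite lerDr sqr_ge0.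
      by rewrite lerDl sqr_ge0.
    by rewrite mulr0 mulr_ge0.
rewrite (integralM_indep mG1 mG2 ind gphi gpsi (trunck _) (trunck _)).
apply: lee_pmul.
- by apply: integral_ge0 => w _; rewrite lee_fin.
- by apply: integral_ge0 => w _; rewrite lee_fin.
- apply: ge0_le_integral => //.
  + by move=> w _; rewrite lee_fin.
  + exact/measurable_EFinP.
  + by apply/measurable_EFinP; exact: measurable_funX.
  + by move=> w _; rewrite lee_fin.
- apply: ge0_le_integral => //.
  + by move=> w _; rewrite lee_fin.
  + exact/measurable_EFinP.
  + by apply/measurable_EFinP; exact: measurable_funX.
  + by move=> w _; rewrite lee_fin.
Qed.

End SquareIntegrable.

(** * Consequences of the step size restriction *)

Section StepSize.
Context {R : realType}.

(** Testing monotonicity and regularity between 0 and a unit vector. *)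
Lemma monotone_le_regular n d (f : 'cV[R]_n -> 'M[R]_(n, d) -> 'cV[R]_n)
    (mu Ly : R) (m : nat) : (0 < n)%N -> (1 < m)%N ->
  monotone_driver f (- mu) -> regular_in_y f Ly m -> mu <= 2 * Ly.
Proof.
move=> n0 m1 fmon fy; pose e : 'cV[R]_n := delta_mx (Ordinal n0) 0.
have e1 : enorm e = 1.
  have: enorm e ^+ 2 = 1.
    rewrite sqr_enormc (bigD1 (Ordinal n0))//= big1 ?addr0 => [|i iN].
      by rewrite mxE !eqxx expr1n.
    by rewrite mxE (negbTE iN) expr0n.
  by move/eqP; rewrite sqrp_eq1 ?enorm_ge0// => /eqP.
have H1 := fmon 0 e 0; have H2 := fy 0 e 0.
rewrite subr0 e1 in H1 H2.
rewrite !expr1n in H1 H2; rewrite enorm0 expr0n mulr1 in H2.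
rewrite (_ : (m.-1 == 0)%N = false) in H2; last by case: (m) m1 => [|[]].
rewrite mulr0n addr0 in H2.
set v := f e 0 - f 0 0 in H1 H2.
have H3 : - edot e v <= enorm v.
  have -> : - edot e v = edot (- e) v.
    by rewrite /edot -sumrN; apply: eq_bigr => i _; rewrite !mxE mulNr.
  apply: le_trans (edot_le_enormM _ _) _.
  suff -> : enorm (- e) = 1 by rewrite mul1r.
  rewrite -e1 /enorm; congr Num.sqrt; apply: eq_bigr => i _.
  by apply: eq_bigr => j _; rewrite mxE sqrrN.
lra.
Qed.

Lemma step_size_bounds (mu Ly R0 alpha h : R) (m d : nat) :
  (0 < d)%N -> (1 < m)%N -> 0 < h -> 0 < R0 -> 0 < mu -> 0 <= Ly ->
  mu <= 2 * Ly -> alpha < 1 / (2 * m.-1%:R) ->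
  h <= Num.min (mu / 4 * (1 / (4 * d.+1%:R * Ly ^+ 2)))
       ((mu / 4 * (1 / (4 * d.+1%:R * Ly ^+ 2 * R0 ^+ (2 * m.-1))))
          `^ (1 / (1 - 2 * m.-1%:R * alpha))) ->
  h * mu <= 2^-1 /\
  h * Ly ^+ 2 * (1 + (R0 * h `^ (- alpha)) ^+ m.-1 ^+ 2) <= mu / 16.
Proof.
move=> d0 m1 h0 R00 mu0 Ly0 muLy am; rewrite le_min => /andP[h1 h2].
have Lyp : 0 < Ly by lra.
have m'0 : 0 < m.-1%:R :> R by rewrite ltr0n -subn1 subn_gt0.
pose D : R := d.+1%:R; have D2 : 2 <= D by rewrite ler_nat.
have Ly2 : 0 < Ly ^+ 2 by rewrite exprn_gt0.
pose r := R0 ^+ (2 * m.-1); have r0 : 0 < r by rewrite exprn_gt0.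
have hLy : h * Ly ^+ 2 * D <= mu / 16.
  rewrite -/D in h1.
  have : h * (Ly ^+ 2 * D) <= mu / 4 * (1 / (4 * D * Ly ^+ 2)) * (Ly ^+ 2 * D).
    by rewrite ler_pM2r// mulr_gt0//; lra.
  rewrite (_ : mu / 4 * _ * _ = mu / 16) ?mulrA//; field.
  by rewrite gt_eqF//= gt_eqF//; lra.
have tha : 0 < 1 - 2 * m.-1%:R * alpha.
  by move: am; rewrite ltr_pdivlMr ?mulr_gt0// mulrC; lra.
set theta := 1 - 2 * m.-1%:R * alpha in tha h2.
have hrho : h * ((R0 * h `^ (- alpha)) ^+ m.-1) ^+ 2 = r * h `^ theta.
  rewrite -exprM mulnC exprMn -/r -powR_mulrn ?powR_ge0// -powRrM.
  rewrite mulrCA; congr (_ * _); rewrite -{1}(powRr1 (ltW h0)) -powRD.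
    by congr (_ `^ _); rewrite /theta natrM; ring.
  by rewrite (gt_eqF h0) implybT.
have hth : r * h `^ theta * Ly ^+ 2 * D <= mu / 16.
  set kap := mu / 4 * _ in h2.
  have kap0 : 0 < kap.
    by rewrite /kap !(mulr_gt0, divr_gt0)// invr_gt0 !mulr_gt0.
  have : h `^ theta <= kap.
    apply: (@le_trans _ _ ((kap `^ (1 / theta)) `^ theta)).
      by apply: ge0_ler_powR; rewrite ?nnegrE ?powR_ge0// ltW.
    by rewrite -powRrM divfK ?gt_eqF// powRr1// ltW.
  move=> hk.
  have : h `^ theta * (r * Ly ^+ 2 * D) <= kap * (r * Ly ^+ 2 * D).
    by rewrite ler_pM2r// !mulr_gt0//; lra.
  rewrite (_ : kap * _ = mu / 16); first by lra.
  rewrite /kap -/D -/r; field.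
  by rewrite !gt_eqF//; lra.
have s1 : h * Ly ^+ 2 * 2 <= h * Ly ^+ 2 * D by rewrite ler_pM2l// mulr_gt0.
split.
  have : mu * mu <= 4 * Ly ^+ 2.
    by rewrite (_ : 4 * Ly ^+ 2 = (2 * Ly) * (2 * Ly)); [rewrite ler_pM// ltW|ring].
  move=> mu2.
  have : h * (mu * mu) <= h * (4 * Ly ^+ 2) by rewrite ler_pM2l.
  move=> H; have : mu * (h * mu) <= mu * 2^-1 by lra.
  by rewrite ler_pM2l.
set rho := (_ ^+ m.-1).
have s2 : r * h `^ theta * Ly ^+ 2 * 2 <= r * h `^ theta * Ly ^+ 2 * D.
  by rewrite ler_pM2l// !mulr_gt0// powR_gt0.
have -> : h * Ly ^+ 2 * (1 + rho ^+ 2) = h * Ly ^+ 2 + Ly ^+ 2 * (h * rho ^+ 2).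
  ring.
rewrite hrho; lra.
Qed.

End StepSize.

(** * Filtrations and moments of the Euler scheme *)

Section BrownianScheme.
Context {R : realType} {disp : measure_display} {Omega : measurableType disp}.
Variable P : probability Omega R.

(** The generators of the natural filtration, of its augmentation and of the
   sigma-algebra of a random matrix, named so that the three sigma-algebras
   are syntactically of the form <<s G>>. *)
Definition past_events d (W : R -> Omega -> 'cV[R]_d) (t : R) : set (set Omega) :=
  [set A | exists s i (B : set R),
     [/\ 0 <= s <= t, measurable B & A = (fun w => W s w i 0) @^-1` B]].

Definition augmented_events d (W : R -> Omega -> 'cV[R]_d) (t : R) :
    set (set Omega) :=
  natural_filtration W t `|` [set A | measurable A /\ P A = 0%E].

Definition entry_events p q (X : Omega -> 'M[R]_(p, q)) : set (set Omega) :=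
  [set A | exists i j (B : set R),
     measurable B /\ A = (fun w => X w i j) @^-1` B].

Lemma entry_events_measurable p q (X : Omega -> 'M[R]_(p, q)) :
  random_mx X -> <<s entry_events X>> `<=` measurable.
Proof.
move=> mX; apply: smallest_sub; first exact: sigma_algebra_measurable.
move=> _ [i [j [B [mB ->]]]].
by have := mX i j measurableT B mB; rewrite setTI.
Qed.

Lemma gmeasurable_entry p q (X : Omega -> 'M[R]_(p, q)) i j :
  gmeasurable (entry_events X) (fun w => X w i j).
Proof.
move=> _ B mB; rewrite setTI; apply: sub_sigma_algebra.
by exists i, j, B.
Qed.

Variables (T : R) (d : nat) (W : R -> Omega -> 'cV[R]_d).
Hypothesis hW : brownian_motion P T W.

Lemma past_events_measurable t : t <= T -> <<s past_events W t>> `<=` measurable.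
Proof.
move=> tT; case: hW => mW _ _ _ _.
apply: smallest_sub; first exact: sigma_algebra_measurable.
move=> _ [s [i [B [/andP[s0 st] mB ->]]]].
have := mW s _ i 0 measurableT B mB; rewrite setTI; apply.
by rewrite s0 (le_trans st).
Qed.

Lemma augmented_events_measurable t : t <= T ->
  <<s augmented_events W t>> `<=` measurable.
Proof.
move=> tT; apply: smallest_sub; first exact: sigma_algebra_measurable.
by move=> A [/(past_events_measurable tT)|[]].
Qed.

Lemma gmeasurable_brownian s t i : 0 <= s <= t ->
  gmeasurable (past_events W t) (fun w => W s w i 0).
Proof.
move=> st _ B mB; rewrite setTI; apply: sub_sigma_algebra.
by exists s, i, B.
Qed.

Lemma gmeasurable_past_mono s t (phi : Omega -> R) : s <= t ->
  gmeasurable (past_events W s) phi -> gmeasurable (past_events W t) phi.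
Proof.
move=> st mphi _ B mB; have := mphi measurableT B mB; rewrite !setTI.
apply: sub_sigma_algebra2 => _ [r [i [B' [/andP[r0 rs] mB' ->]]]].
by exists r, i, B'; split=> //; rewrite r0 (le_trans rs).
Qed.

Lemma half_holder_lipschitzE p q (b : R -> 'cV[R]_d -> 'M[R]_(p, q)) :
  half_holder_lipschitz T b -> exists K, forall t, 0 <= t <= T ->
  forall x y, enorm (b t x - b t y) <= K * enorm (x - y).
Proof.
move=> [K HK]; exists K => t tT x y; have := HK t t x y tT tT.
by rewrite subrr normr0 sqrtr0 add0r.
Qed.

Section Grid.
Variables (N : nat) (h : R).
Hypotheses (h0 : 0 < h) (hT : N%:R * h = T).

Lemma grid_le i : (i <= N)%N -> i%:R * h <= T.
Proof. by move=> iN; rewrite -hT ler_pM2r// ler_nat. Qed.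

Lemma grid_ge0 i : 0 <= i%:R * h.
Proof. by rewrite mulr_ge0// ltW. Qed.

Lemma grid_lt i : i%:R * h < i.+1%:R * h.
Proof. by rewrite ltr_pM2r// ltr_nat ltnSn. Qed.

Let increment i w := W (i.+1%:R * h) w - W (i%:R * h) w.

Variables (x0 : 'cV[R]_d) (b : R -> 'cV[R]_d -> 'cV[R]_d)
  (sigma : R -> 'cV[R]_d -> 'M[R]_d).
Hypotheses (hb : half_holder_lipschitz T b)
  (hsigma : half_holder_lipschitz T sigma).

Local Notation Xe := (euler h W x0 b sigma).

Lemma euler_entry i w k : Xe i.+1 w k 0 =
  Xe i w k 0 + h * b (i%:R * h) (Xe i w) k 0
  + \sum_l sigma (i%:R * h) (Xe i w) k l * increment i w l 0.
Proof. by rewrite /= !mxE. Qed.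

Lemma euler_gmeasurable i : (i <= N)%N -> forall k,
  gmeasurable (past_events W (i%:R * h)) (fun w => Xe i w k 0).
Proof.
have [Kb HKb] := half_holder_lipschitzE hb.
have [Ks HKs] := half_holder_lipschitzE hsigma.
elim: i => [|i IH] iN k; first exact: measurable_cst.
have iT : 0 <= i%:R * h <= T by rewrite grid_ge0 grid_le// ltnW.
set G := past_events W (i.+1%:R * h).
have ii : i%:R * h <= i.+1%:R * h := ltW (grid_lt i).
have mX : random_mx (Xe i : g_sigma_algebraType G -> 'cV[R]_d).
  by move=> l j; rewrite (ord1 j); apply: (gmeasurable_past_mono ii);
    apply: IH; exact: ltnW.
under [X in gmeasurable _ X]eq_fun do rewrite euler_entry.
apply: measurable_funD; first apply: measurable_funD.
- exact: mX.
- apply: measurable_funM; first exact: measurable_cst.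
  exact: (random_mx_lipschitz (HKb _ iT) mX).
- apply: measurable_sum => l; apply: measurable_funM.
    exact: (random_mx_lipschitz (HKs _ iT) mX).
  under eq_fun do rewrite !mxE.
  apply: measurable_funB; apply: gmeasurable_brownian; rewrite grid_ge0//=.
Qed.

Lemma random_increment i : (i < N)%N -> random_mx (increment i).
Proof.
move=> iN k j; rewrite (ord1 j) /increment; case: hW => mW _ _ _ _.
under eq_fun do rewrite !mxE.
by apply: measurable_funB; apply: mW; rewrite grid_ge0 grid_le// ltnW.
Qed.

Variables (L C : R) (H : nat -> Omega -> 'cV[R]_d).
Hypothesis hH : scheme_weights P h N W L C H.

(** Divided by h, the increment differs from the square integrable weight by a
   remainder whose second moment is at most C h. *)
Lemma sqint_increment i : (i < N)%N -> sqint_mx P (increment i).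
Proof.
move=> iN k j; rewrite (ord1 j); have [Hm _ _ [_ HH] Hd] := hH iN.
have mH : random_mx (H i.+1).
  move=> l j'; have := (wrtP (augmented_events W (i.+1%:R * h)) (H i.+1)).1 Hm l j'.
  by apply: gmeasurable_measurable; apply: augmented_events_measurable;
    exact: grid_le.
have sH l : sqint P (fun w => H i.+1 w l 0).
  split; first exact: mH.
  have [+ _ _] := HH l l; apply: eq_integrable => // w _ /=.
  by rewrite !mxE big_ord1 !mxE expr2.
pose D w := h^-1 *: increment i w - H i.+1 w.
have mD : random_mx D.
  move=> l j'; rewrite (_ : (fun w => D w l j') =
    (fun w => h^-1 * increment i w l j' - H i.+1 w l j')); last first.
    by apply/funext => w; rewrite !mxE.
  apply: measurable_funB => //; apply: measurable_funM => //.
  exact: random_increment.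
have sDn : sqint P (fun w => enorm (D w)).
  have mDn := measurable_enorm mD; split=> //.
  apply/integrableP; split; first by apply/measurable_EFinP; exact: measurable_funX.
  under eq_integral do rewrite /= ger0_norm ?sqr_ge0//.
  by apply: le_lt_trans Hd _; exact: ltry.
have sD : sqint P (fun w => D w k 0).
  apply: sqint_le sDn; first exact: mD.
  by move=> w; rewrite (ger0_norm (enorm_ge0 _)) normr_entry_le.
have := sqintZ h (sqintD (sH k) sD).
rewrite (_ : (fun _ => _) = (fun w => increment i w k 0))//.
by apply/funext => w; rewrite /D /increment !mxE; field; rewrite gt_eqF.
Qed.

(** In each product of an entry of sigma with a Brownian increment the first
   factor is known at time t_i and the second is independent of the past. *)
Lemma sqint_euler i : (i <= N)%N -> sqint_mx P (Xe i).
Proof.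
have [Kb HKb] := half_holder_lipschitzE hb.
have [Ks HKs] := half_holder_lipschitzE hsigma.
elim: i => [|i IH] iN k j; rewrite (ord1 j); first exact: sqint_cst.
have iT : 0 <= i%:R * h <= T by rewrite grid_ge0 grid_le// ltnW.
have sX := IH (ltnW iN).
rewrite (_ : (fun _ => _) = (fun w =>
  Xe i w k 0 + h * b (i%:R * h) (Xe i w) k 0
  + \sum_l sigma (i%:R * h) (Xe i w) k l * increment i w l 0)); last first.
  by apply/funext => w; exact: euler_entry.
apply: sqintD; first apply: sqintD.
- exact: sX.
- by apply: sqintZ; exact: (sqint_lipschitz (HKb _ iT) sX).
- apply: sqint_sum => l.
  have [_ _ _ ind _] := hW.
  apply: (sqintM_indep (G1 := past_events W (i%:R * h))
                       (G2 := entry_events (increment i))).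
  + by apply: past_events_measurable; rewrite grid_le// ltnW.
  + exact: entry_events_measurable (random_increment iN).
  + by apply: ind; rewrite ?grid_ge0 ?grid_lt ?grid_le.
  + apply: (@random_mx_lipschitz _ _
      (g_sigma_algebraType (past_events W (i%:R * h))) _ _ _ _ _ _ _ (HKs _ iT)).
    by move=> l' j'; rewrite (ord1 j'); apply: euler_gmeasurable; exact: ltnW.
  + exact: gmeasurable_entry.
  + exact: (sqint_lipschitz (HKs _ iT) sX).
  + exact: sqint_increment.
Qed.

End Grid.
End BrownianScheme.

(** * The L^2 norm and the stability estimate *)

Section L2norm.
Context {R : realType} {disp : measure_display} {Omega : measurableType disp}.
Variable P : probability Omega R.

Lemma L2normE p q (X : Omega -> 'M[R]_(p, q)) :
  L2norm P X = ((\int[P]_w (enorm (X w) ^+ 2)%:E) `^ 2^-1)%E.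
Proof.
rewrite /L2norm unlock; congr (_ `^ _)%E; apply: eq_integral => w _.
by rewrite /= powR_mulrn// ger0_norm// enorm_ge0.
Qed.

Lemma L2norm_gt0 p q (X : Omega -> 'M[R]_(p, q)) : random_mx X ->
  ~ as_zero P X -> (0 < L2norm P X)%E.
Proof.
move=> mX X0; rewrite lt0e Lnorm_ge0 andbT; apply/negP => /eqP L0; apply: X0.
have := @Lnorm_eq0_eq0 _ _ _ P (fun w => (enorm (X w))%:E) 2%:E _ _ L0.
move=> /(_ _ _)[].
- by apply/measurable_EFinP; exact: measurable_enorm.
- by rewrite lte_fin.
move=> A [mA A0 XA]; exists A; split=> // w /= Xw; apply: XA => /= XE.
apply: Xw; have [e0] := XE I; apply/matrixP => i j; rewrite mxE.
by have := normr_entry_le (X w) i j; rewrite e0 normr_le0 => /eqP.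
Qed.

End L2norm.

Theorem mainTheorem4 (R : realType) (disp : measure_display)
    (Omega : measurableType disp) (P : probability Omega R)
    (d n : nat) (hd : (0 < d)%N) (hn : (0 < n)%N)
    (T : R) (hT : 0 < T)
    (W : R -> Omega -> 'cV[R]_d) (hW : brownian_motion P T W)
    (x0 : 'cV[R]_d)
    (b : R -> 'cV[R]_d -> 'cV[R]_d) (hb : half_holder_lipschitz T b)
    (sigma : R -> 'cV[R]_d -> 'M[R]_d) (hsigma : half_holder_lipschitz T sigma)
    (g : 'cV[R]_d -> 'cV[R]_n) (hg : lipschitz_fun g)
    (f : 'cV[R]_n -> 'M[R]_(n, d) -> 'cV[R]_n)
    (My Ly Lz : R) (m : nat) (hLy : 0 <= Ly) (hLz : 0 <= Lz) (hm : (2 <= m)%N)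
    (hMon : monotone_driver f My)
    (hRegY : regular_in_y f Ly m)
    (hRegZ : regular_in_z f Lz)
    (hf0 : f 0 0 = 0) (hMy : My < 0)
    (* the continuous-time forward process and xi = g(X_T) *)
    (X : R -> Omega -> 'cV[R]_d) (hX : sde_solution P T W x0 b sigma X)
    (hxi2 : (L2norm P (fun w => g (X T w)) < +oo)%E)
    (hxi0 : ~ as_zero P (fun w => g (X T w)))
    (R0 alpha C : R) (hR0 : 0 < R0) (halpha : 0 < alpha) (hC : 0 < C)
    (N : nat) (hN : (0 < N)%N) (h : R) (hh : h = T / N%:R)
    (Th : 'cV[R]_n -> 'cV[R]_n)
    (hTh : ball_projection (R0 * h `^ (- alpha)) Th)
    (Lambda : R) (hLambda : Lambda <= 1)
    (H : nat -> Omega -> 'cV[R]_d) (hH : scheme_weights P h N W Lambda C H)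
    (xiN : Omega -> 'cV[R]_n)
    (hxiN : xiN = fun w => g (euler h W x0 b sigma N w))
    (Y : nat -> Omega -> 'cV[R]_n) (Z : nat -> Omega -> 'M[R]_(n, d))
    (hYZ : full_projection_scheme P h N W f Th H xiN Y Z)
    (hLzMy : 8 * Lz ^+ 2 <= - My)
    (halpham : alpha < 1 / (2 * m.-1%:R))
    (hsmall : h <= Num.min
       (- My / 4 * (1 / (4 * d.+1%:R * Ly ^+ 2)))
       ((- My / 4 * (1 / (4 * d.+1%:R * Ly ^+ 2 * R0 ^+ (2 * m.-1))))
          `^ (1 / (1 - 2 * m.-1%:R * alpha)))) :
  forall i, (i < N)%N ->
    (L2norm P (Y i)
       <= (expR (My / 2 * (T - i%:R * h)))%:E * L2norm P xiN)%E
    /\ (~ as_zero P xiN ->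
        ((expR (My / 2 * (T - i%:R * h)))%:E * L2norm P xiN
           < L2norm P xiN)%E).
Proof.
pose mu := - My.
have mu0 : 0 < mu by rewrite oppr_gt0.
have MyE : My = - mu by rewrite opprK.
rewrite MyE in hMon.
have N0 : 0 < N%:R :> R by rewrite ltr0n.
have h0 : 0 < h by rewrite hh divr_gt0.
have NhT : N%:R * h = T by rewrite hh mulrC divfK// gt_eqF.
have [hmu hLy2] := step_size_bounds hd hm h0 hR0 mu0 hLy
  (monotone_le_regular hn hm hMon hRegY) halpham hsmall.
have [Th_le Th_r _ Th_lip] := hTh.
have [YN Yrec] := hYZ.
have mG i : (i <= N)%N -> <<s augmented_events P W (i%:R * h)>> `<=` measurable.
  by move=> iN; apply: (augmented_events_measurable hW); exact: (grid_le h0 NhT).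
have [Kg HKg] := hg.
have sxi : sqint_mx P xiN.
  rewrite hxiN; apply: (sqint_lipschitz HKg).
  exact: (sqint_euler hW h0 NhT x0 hb hsigma hH).
have mY i : (i <= N)%N -> random_mx (Y i).
  rewrite leq_eqVlt => /predU1P[->|iN].
    by rewrite YN; exact: sqint_random_mx sxi.
  move=> k j; have [_ [/(wrtP (augmented_events P W (i%:R * h)))/(_ k j) + _]] :=
    Yrec i iN.
  by apply: gmeasurable_measurable; exact: mG (ltnW iN).
pose E i := (\int[P]_w (enorm (Y i w) ^+ 2)%:E)%E.
have E0 i : (0 <= E i)%E.
  by apply: integral_ge0 => w _; rewrite lee_fin sqr_ge0.
have step i : (i < N)%N -> (E i <= (expR (- (mu * h)))%:E * E i.+1)%E.
  move=> iN; have [HZ HY] := Yrec i iN.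
  have [_ _ He Hee _] := hH i iN.
  have mTh : random_mx (fun w => Th (Y i.+1 w)).
    apply: (@random_mx_lipschitz _ _ _ _ _ _ _ Th 1) (mY _ iN) => x y.
    by rewrite mul1r.
  have mu1 : 0 <= 1 - h * mu by lra.
  apply: le_trans (condexp_step_le (mG i (ltnW iN)) h0 hLambda mu1 mTh
    (fun w => Th_r _) HZ HY He Hee _) _.
    move=> w; apply: (driver_dissipation (Z i w) hm hLy hLz h0 (ltW mu0) hMon hRegY hRegZ
      hf0 hLzMy hmu _ hLy2).
    apply: lerXn2r; rewrite ?nnegrE ?enorm_ge0//.
    by apply: le_trans (Th_r (Y i.+1 w)); exact: enorm_ge0.
  apply: lee_pmul.
  - by rewrite lee_fin.
  - by apply: integral_ge0 => w _; rewrite lee_fin sqr_ge0.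
  - by rewrite lee_fin mulrC; have := expR_ge1Dx (- (mu * h)).
  - apply: ge0_le_integral => //.
    + by move=> w _; rewrite lee_fin sqr_ge0.
    + by apply/measurable_EFinP; apply: measurable_funX; exact: measurable_enorm.
    + apply/measurable_EFinP; apply: measurable_funX; apply: measurable_enorm.
      exact: mY.
    + by move=> w _; rewrite lee_fin ler_pXn2r ?nnegrE ?enorm_ge0.
have decay k : (k <= N)%N -> (E (N - k)%N <= (expR (- (mu * (k%:R * h))))%:E * E N)%E.
  elim: k => [|k IH] kN.
    by rewrite subn0 mul0r mulr0 oppr0 expR0 mul1e.
  have Nk : (N - k.+1 < N)%N by rewrite ltn_subrL hN.
  apply: le_trans (step _ Nk) _; rewrite subnSK//.
  apply: le_trans (lee_wpmul2l _ (IH (ltnW kN))) _.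
    by rewrite lee_fin expR_ge0.
  rewrite muleA -EFinM -expRD le_eqVlt; apply/orP; left; apply/eqP.
  by congr ((expR _)%:E * _)%E; rewrite -natr1; ring.
move=> i iN.
have TE : T - i%:R * h = (N - i)%:R * h.
  by rewrite -NhT natrB ?(ltnW iN)// mulrBl.
have EN : E N = (\int[P]_w (enorm (xiN w) ^+ 2)%:E)%E by rewrite /E YN.
split=> [|xi0].
  rewrite !L2normE TE -EN -/(E i).
  have := decay _ (leq_subr i N); rewrite subKn ?(ltnW iN)// => Ei.
  have -> : (expR (My / 2 * ((N - i)%:R * h)))%:E
      = ((expR (- (mu * ((N - i)%:R * h))))%:E `^ 2^-1)%E.
    by rewrite poweR_EFin -expRM; congr (expR _)%:E; rewrite /mu; field.
  rewrite -poweRM ?lee_fin ?expR_ge0//.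
  apply: gt0_ler_poweR => //; rewrite in_itv/= leey andbT//.
  by rewrite mule_ge0// lee_fin expR_ge0.
have L0 := L2norm_gt0 (sqint_random_mx sxi) xi0.
have Lfin : (L2norm P xiN < +oo)%E.
  by rewrite L2normE; apply: poweR_lty; exact: sqint_mx_lty.
rewrite -[X in (_ < X)%E]mul1e lte_pmul2r//; last by rewrite ge0_fin_numE// ltW.
rewrite lte_fin -[ltRHS]expR0 ltr_expR TE nmulr_rlt0.
  by rewrite mulr_gt0// ltr0n subn_gt0.
by rewrite pmulr_llt0// invr_gt0.
Qed.
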